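(* Let $\mathbb{G}$ be a Green kernel of type $(s,\gamma)$ on $\Omega$ with Green operator $\mathcal{G}$, and let $f\in L^1(\Omega,\delta^\gamma)$. Then there exists a unique function $u\in L^1_{loc}(\Omega)$ satisfying $$\int_\Omega u\,\psi=\int_\Omega f\,\mathcal{G}(\psi)\qquad\text{for any }\psi\in L^\infty_c(\Omega).$$ This function is precisely $u=\mathcal{G}(f)$, and it satisfies $$\int_K|u|\le\|f\delta^\gamma\|_{L^1(\Omega)}\left\|\frac{\mathcal{G}(\chi_K)}{\delta^\gamma}\right\|_{L^\infty(\Omega)}\qquad\text{for any }K\Subset\Omega.$$
   Context: $\Omega\subset\mathbb{R}^n$ ($n\ge1$) is a bounded domain with $C^{1,1}$ boundary and $\delta(x)=\mathrm{dist}(x,\partial\Omega)$. Write $a\wedge b=\min\{a,b\}$. For nonnegative functions, $f\asymp g$ on a set means that there is a constant $C>0$ with $C^{-1}g\le f\le Cg$ on that set. $L^1(\Omega,\delta^\gamma)$ is the set of measurable $f$ on $\Omega$ with $f\delta^\gamma\in L^1(\Omega)$. $L^\infty_c(\Omega)$ is the space of bounded measurable functions with compact support in $\Omega$. $K\Subset\Omega$ means that $K$ is a compact subset of $\Omega$; $\chi_K$ is its indicator function. A Green kernel of type $(s,\gamma)$ on $\Omega$, where $s,\gamma\in(0,1]$ and $2s\le n$, is a measurable function $\mathbb{G}:\Omega\times\Omega\to\mathbb{R}$ such that $\mathbb{G}(x,y)=\mathbb{G}(y,x)$ and $$\mathbb{G}(x,y)\asymp\frac{1}{|x-y|^{n-2s}}\Big(\frac{\delta(x)\delta(y)}{|x-y|^2}\wedge1\Big)^\gamma,\qquad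 x,y\in\Omega,\ x\ne y.$$ Its Green operator is $\mathcal{G}(f)(x)=\int_\Omega\mathbb{G}(x,y)f(y)\,dy$. *)

(* Defs.v *)
From HB Require Import structures.
From mathcomp Require Import all_boot all_order all_algebra.
From mathcomp Require Import all_classical all_reals all_analysis.

Set Implicit Arguments.
Unset Strict Implicit.
Unset Printing Implicit Defensive.

Import Order.TTheory GRing.Theory Num.Theory.
Import numFieldNormedType.Exports.

Local Open Scope classical_set_scope.
Local Open Scope ring_scope.

Definition rV_display : measure_display.
Proof. exact: default_measure_display. Qed.

Section borel_rV.
Context {R : realType} (n : nat).

Let coord : 'I_n -> 'rV[R]_n -> R := fun i v => v ord0 i.

Let rV_set0 : g_sigma_preimage coord set0.
Proof. exact: sigma_algebra0. Qed.

Let rV_setC A : g_sigma_preimage coord A -> g_sigma_preimage coord (~` A).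
Proof. exact: sigma_algebraC. Qed.

Let rV_bigcup (F : _^nat) : (forall i, g_sigma_preimage coord (F i)) ->
  g_sigma_preimage coord (\bigcup_i (F i)).
Proof. exact: sigma_algebra_bigcup. Qed.

HB.instance Definition _ := @isMeasurable.Build rV_display
  'rV[R]_n (g_sigma_preimage coord) rV_set0 rV_setC rV_bigcup.

End borel_rV.

Lemma measurable_coord (R : realType) n (i : 'I_n) :
  measurable_fun [set: 'rV[R]_n] (fun v : 'rV[R]_n => v ord0 i).
Proof.
move=> _ Y mY; rewrite setTI; apply: sub_sigma_algebra => /=.
rewrite -bigcup_seq/=; exists i => /=; first by rewrite mem_index_enum.
by exists Y => //; rewrite setTI.
Qed.

Lemma measurable_fun_rVP d (T : measurableType d) (R : realType) n
    (f : T -> 'rV[R]_n) :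
  (forall i, measurable_fun [set: T] (fun x => f x ord0 i)) ->
  measurable_fun [set: T] f.
Proof.
move=> mf.
have H : g_sigma_preimage (fun i => (fun v : 'rV[R]_n => v ord0 i) \o f)
    `<=` measurable.
  apply: smallest_sub; first exact: sigma_algebra_measurable.
  move=> A; rewrite -bigcup_seq/= => -[i _ [B mB <-]].
  exact: mf.
by move=> _ A mA; apply: H; rewrite g_sigma_preimage_comp; exists A.
Qed.

Definition rV_cons (R : realType) n (p : R * 'rV[R]_n) : 'rV[R]_n.+1 :=
  \row_i (if unlift ord0 i is Some j then p.2 ord0 j else p.1).

Definition rV_uncons (R : realType) n (v : 'rV[R]_n.+1) : R * 'rV[R]_n :=
  (v ord0 ord0, \row_j v ord0 (lift ord0 j)).

Lemma rV_consK (R : realType) n : cancel (@rV_cons R n) (@rV_uncons R n).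
Proof.
move=> [a v]; congr pair; first by rewrite mxE unlift_none.
by apply/rowP => j; rewrite !mxE liftK.
Qed.

Lemma measurable_rV_cons (R : realType) n :
  measurable_fun [set: measurableTypeR R * 'rV[R]_n] (@rV_cons R n).
Proof.
apply: measurable_fun_rVP => i; case: (unliftP ord0 i) => [j|] ->.
- rewrite (_ : (fun _ => _) = (fun v : 'rV[R]_n => v ord0 j) \o snd).
    by apply: measurableT_comp => //; exact: measurable_coord.
  by apply/funext => p /=; rewrite mxE liftK.
- rewrite (_ : (fun _ => _) = fst)//.
  by apply/funext => p /=; rewrite mxE unlift_none.
Qed.

Lemma measurable_rV_uncons (R : realType) n :
  measurable_fun [set: 'rV[R]_n.+1]
    (@rV_uncons R n : _ -> measurableTypeR R * 'rV[R]_n).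
Proof.
apply: measurable_fun_pair; first exact: measurable_coord.
apply: measurable_fun_rVP => i; under eq_fun do rewrite mxE.
exact: measurable_coord.
Qed.

Section lebesgue_cons.
Context {R : realType} (n : nat).
Variable m : {sigma_finite_measure set 'rV[R]_n -> \bar R}.

Definition lebesgue_cons : set 'rV[R]_n.+1 -> \bar R :=
  pushforward (@lebesgue_measure R \x m)%E (@rV_cons R n).

Let mcons := @measurable_rV_cons R n.

Let lebesgue_cons0 : lebesgue_cons set0 = 0%E.
Proof. by rewrite /lebesgue_cons /pushforward preimage_set0 measure0. Qed.

Let lebesgue_cons_ge0 A : (0 <= lebesgue_cons A)%E.
Proof. exact: measure_ge0. Qed.

Let lebesgue_cons_sigma_additive : semi_sigma_additive lebesgue_cons.
Proof.
move=> F mF tF mUF; rewrite /lebesgue_cons /pushforward preimage_bigcup.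
apply: measure_semi_sigma_additive.
- by move=> k; rewrite -[X in measurable X]setTI; exact: mcons.
- apply/trivIsetP => /= i j _ _ ij; rewrite -preimage_setI.
  by move/trivIsetP : tF => /(_ _ _ _ _ ij) ->//; rewrite preimage_set0.
- by rewrite -preimage_bigcup -[X in measurable X]setTI; exact: mcons.
Qed.

HB.instance Definition _ := isMeasure.Build _ _ _ lebesgue_cons
  lebesgue_cons0 lebesgue_cons_ge0 lebesgue_cons_sigma_additive.

Let sigma_finite_lebesgue_cons : sigma_finite setT lebesgue_cons.
Proof.
have /sigma_finiteP[F [TF ndF Foo]] := sigma_finiteT (@lebesgue_measure R).
have /sigma_finiteP[G [TG ndG Goo]] := sigma_finiteT m.
exists (fun k => @rV_uncons R n @^-1` (F k `*` G k)).
  apply/esym; rewrite -subTset => v _.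
  have : [set: R] (v ord0 ord0) by [].
  rewrite TF => -[i _ Fi].
  have : [set: 'rV[R]_n] (rV_uncons v).2 by [].
  rewrite TG => -[j _ Gj].
  exists (maxn i j) => //; split => /=.
  - by move: Fi; exact/subsetPset/ndF/leq_maxl.
  - by move: Gj; exact/subsetPset/ndG/leq_maxr.
move=> k; have [mF ?] := Foo k; have [mG ?] := Goo k; split.
  rewrite -[X in measurable X]setTI; apply: measurable_rV_uncons => //.
  exact: measurableX.
rewrite /lebesgue_cons /pushforward -comp_preimage.
rewrite (_ : _ \o _ = id); last by apply/funext => p /=; rewrite rV_consK.
by rewrite preimage_id product_measure1E// lte_mul_pinfty// ge0_fin_numE.
Qed.

HB.instance Definition _ := Measure_isSigmaFinite.Build _ _ _ lebesgue_cons
  sigma_finite_lebesgue_cons.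

End lebesgue_cons.

Fixpoint lebesgue_rV (R : realType) n :
    {sigma_finite_measure set 'rV[R]_n -> \bar R} :=
  if n is k.+1 then lebesgue_cons (lebesgue_rV R k) else dirac (0 : 'rV[R]_0).

Lemma lebesgue_rV_box (R : realType) n (A : 'I_n -> set (measurableTypeR R)) :
  (forall i, measurable (A i)) ->
  lebesgue_rV R n [set v : 'rV[R]_n | forall i, A i (v ord0 i)] =
  (\prod_(i < n) lebesgue_measure (A i))%E.
Proof.
elim: n A => [|n IH] A mA.
  rewrite big_ord0 /= diracE mem_set//; by case.
rewrite big_ord_recl -IH => [|i]; last exact: mA.
have E : @rV_cons R n @^-1` [set v | forall i, A i (v ord0 i)] =
    A ord0 `*` [set v : 'rV[R]_n | forall i, A (lift ord0 i) (v ord0 i)].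
  apply/seteqP; split => -[a v] /=.
    move=> h; split => [|i]; first by have := h ord0; rewrite mxE unlift_none.
    by have := h (lift ord0 i); rewrite mxE liftK.
  move=> [h0 h] i; case: (unliftP ord0 i) => [j|] ->.
    by rewrite mxE liftK.
  by rewrite mxE unlift_none.
transitivity ((@lebesgue_measure R \x lebesgue_rV R n)%E
  (@rV_cons R n @^-1` [set v | forall i, A i (v ord0 i)])); first by [].
rewrite E product_measure1E//.
rewrite (_ : [set _ | _] = \bigcap_(i in [set: 'I_n])
    ((fun v : 'rV[R]_n => v ord0 i) @^-1` A (lift ord0 i))).
  apply: fin_bigcap_measurable => // i _.
  by rewrite -[X in measurable X]setTI; apply: measurable_coord => //; exact: mA.
by apply/seteqP; split => v /= h i => [_|]; exact: h.
Qed.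

(** The completion of a measure [mu]: its sigma-algebra consists of the
    Caratheodory measurable sets of the outer measure [mu^*], that is, of the
    Lebesgue measurable sets when [mu] is [lebesgue_rV R n] or
    [lebesgue_rV R n \x lebesgue_rV R n]. *)

Notation completionType mu := (caratheodory_type (mu^*)%mu).

Definition lebesgue (R : realType) n :
    {measure set (completionType (lebesgue_rV R n)) -> \bar R} :=
  @completed_measure_extension _ _ _ (lebesgue_rV R n).

Definition lmeasurable_fun (R : realType) n (D : set 'rV[R]_n)
    (f : 'rV[R]_n -> R) :=
  measurable_fun (D : set (completionType (lebesgue_rV R n))) f.

Definition lmeasurable_fun2 (R : realType) n (D : set ('rV[R]_n * 'rV[R]_n))
    (f : 'rV[R]_n * 'rV[R]_n -> R) :=
  measurable_fun
    (D : set (completionType (lebesgue_rV R n \x lebesgue_rV R n)%E)) f.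

(** The norm provided by the library on ['rV[R]_n] is the max norm; topological
    notions do not depend on the choice of the norm. *)

Definition enorm (R : realType) n (x : 'rV[R]_n) : R :=
  Num.sqrt (\sum_(i < n) x ord0 i ^+ 2).

Definition bdry (T : topologicalType) (A : set T) := closure A `\` A°.

Definition dist_bdry (R : realType) n (Omega : set 'rV[R]_n) (x : 'rV[R]_n) : R :=
  inf [set enorm (x - y) | y in bdry Omega].

Definition C11 (R : realType) m (phi : 'rV[R]_m -> R) :=
  (forall y, differentiable phi y) /\
  (forall i : 'I_m, lipschitz (fun y => 'D_(delta_mx ord0 i) phi y : R)).

(** Near each boundary point, in suitable orthonormal coordinates, [Omega] lies
    strictly above the graph of a C^{1,1} function of the remaining n - 1
    coordinates. [col' j] deletes the [j]-th coordinate. *)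
Definition C11_boundary (R : realType) n (Omega : set 'rV[R]_n) :=
  forall x0, bdry Omega x0 ->
  exists (r : R) (Q : 'M[R]_n) (j : 'I_n) (phi : 'rV[R]_n.-1 -> R),
    [/\ 0 < r, Q *m Q^T = 1%:M, C11 phi &
      forall x, enorm (x - x0) < r ->
        (Omega x <-> phi (col' j (x *m Q)) < (x *m Q) ord0 j)].

Definition C11_bounded_domain (R : realType) n (Omega : set 'rV[R]_n) :=
  [/\ Omega !=set0, open Omega, connected Omega, bounded_set Omega &
      C11_boundary Omega].

Definition L1_weighted (R : realType) n (Omega : set 'rV[R]_n) (gamma : R)
    (f : 'rV[R]_n -> R) :=
  lmeasurable_fun Omega f /\
  (lebesgue R n).-integrable Omega
    (fun x => (f x * dist_bdry Omega x `^ gamma)%:E).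

Definition L1_loc (R : realType) n (Omega : set 'rV[R]_n) (u : 'rV[R]_n -> R) :=
  lmeasurable_fun Omega u /\
  forall K : set 'rV[R]_n, compact K -> K `<=` Omega ->
    (lebesgue R n).-integrable K (EFin \o u).

Definition Linfty_c (R : realType) n (Omega : set 'rV[R]_n)
    (psi : 'rV[R]_n -> R) :=
  let supp := closure [set x | Omega x /\ psi x != 0] in
  [/\ lmeasurable_fun Omega psi,
      exists M : R, forall x, Omega x -> `|psi x| <= M,
      compact supp & supp `<=` Omega].

Definition asymp_on (T : Type) (R : realType) (D : set T) (f g : T -> R) :=
  exists2 C : R, 0 < C & forall p, D p -> C^-1 * g p <= f p <= C * g p.

Definition green_profile (R : realType) n (s gamma : R) (Omega : set 'rV[R]_n)
    (x y : 'rV[R]_n) : R :=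
  let d := dist_bdry Omega in
  (enorm (x - y) `^ (n%:R - 2 * s))^-1 *
  (Num.min (d x * d y / enorm (x - y) ^+ 2) 1) `^ gamma.

Definition green_kernel (R : realType) n (s gamma : R) (Omega : set 'rV[R]_n)
    (G : 'rV[R]_n -> 'rV[R]_n -> R) :=
  [/\ [/\ 0 < s <= 1, 0 < gamma <= 1 & 2 * s <= n%:R],
      lmeasurable_fun2 (Omega `*` Omega) (fun p => G p.1 p.2),
      forall x y, Omega x -> Omega y -> G x y = G y x &
      asymp_on [set p | [/\ Omega p.1, Omega p.2 & p.1 != p.2]]
        (fun p => G p.1 p.2) (fun p => green_profile s gamma Omega p.1 p.2)].

(** The integral takes values in [\bar R]. By the conventions of the library it
    is [-oo] when the positive and the negative part both have infinite integral,
    so a finite value means that the integral converges absolutely. *)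
Definition green_op (R : realType) n (Omega : set 'rV[R]_n)
    (G : 'rV[R]_n -> 'rV[R]_n -> R) (f : 'rV[R]_n -> R) (x : 'rV[R]_n) : \bar R :=
  (\int[lebesgue R n]_(y in Omega) (G x y * f y)%:E)%E.

Definition dual_solution (R : realType) n (Omega : set 'rV[R]_n)
    (G : 'rV[R]_n -> 'rV[R]_n -> R) (f u : 'rV[R]_n -> R) :=
  L1_loc Omega u /\
  forall psi, Linfty_c Omega psi ->
    (\int[lebesgue R n]_(x in Omega) (u x * psi x)%:E =
     \int[lebesgue R n]_(x in Omega) ((f x)%:E * green_op Omega G psi x))%E.

(* Main.v *)
Require Import Defs.
From HB Require Import structures.
From mathcomp Require Import all_boot all_order all_algebra.
From mathcomp Require Import all_classical all_reals all_analysis.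
From mathcomp Require Import measurable_realfun ess_sup_inf.
From mathcomp Require Import ring lra.
Set Implicit Arguments.
Unset Strict Implicit.
Unset Printing Implicit Defensive.
Import Order.TTheory GRing.Theory Num.Theory.
Import numFieldNormedType.Exports.
Local Open Scope classical_set_scope.
Local Open Scope ring_scope.

(** Write [k] for a Borel version of the kernel and [f0] for one of [f]. By
    Tonelli and the symmetry of [k], the integral of [k |f0|] over a compact set
    [K] is the integral of [|f0|] against the potential of [K], which is at most
    [C * dist ^ gamma]: near the boundary the factor
    [(dist x dist y / |x - y|^2) ^ gamma] of the profile provides the decay,
    elsewhere the kernel is dominated by the integrable Riesz kernel
    [|x - y| ^ (2 s - n)]. So [k f0] is locally integrable, Fubini gives the
    duality formula, and the best constant [C] is the essential supremum in the
    estimate. Uniqueness follows by testing against indicators of measurable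
    subsets of compact sets.

    The data are only Lebesgue measurable, whereas Tonelli and Fubini are
    available for Borel functions; the integrals are transferred through Borel
    versions that agree with the data outside Borel null sets. *)

(** * The completion of a measure *)

(** Kept generic because both [lebesgue_rV R n] and its product with itself get completed;
    [lebesgue R n] unfolds to an instance. *)
Definition completion d (T : measurableType d) (R : realType)
    (mu : {measure set T -> \bar R}) :
    {measure set (completionType mu) -> \bar R} :=
  @completed_measure_extension _ _ _ mu.

Section completion.
Context d (T : measurableType d) (R : realType) (mu : {measure set T -> \bar R}).
Local Open Scope ereal_scope.

Local Notation cT := (completionType mu).
Local Notation cmu := (completion mu).

Lemma measurable_completion (A : set T) :
  measurable A -> measurable (A : set cT).
Proof. exact: caratheodory_measurable_mu_ext. Qed.

Lemma completionE (A : set T) : measurable A -> cmu A = mu A.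
Proof. exact: measurable_mu_extE. Qed.

Lemma completion_complete : measure_is_complete cmu.
Proof.
by move=> A hA; apply: (@measure_is_complete_caratheodory R T (mu^*)%mu).
Qed.

Lemma measurable_fun_completion d' (T' : measurableType d') (D : set T)
    (f : T -> T') :
  measurable D -> measurable_fun D f -> measurable_fun (D : set cT) f.
Proof. by move=> mD mf _ Y mY; apply: measurable_completion; exact: mf. Qed.

(** The identity is measurable from the completed space to the original one, and the image of [cmu]
    under it agrees with [mu] on measurable sets. *)
Lemma ge0_integral_completion (D : set T) (f : T -> \bar R) :
  measurable D -> measurable_fun D f -> (forall x, D x -> 0 <= f x) ->
  \int[cmu]_(x in D) f x = \int[mu]_(x in D) f x.
Proof.
move=> mD mf f0.
have mid : measurable_fun [set: cT] (idfun : cT -> T).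
  by move=> _ Y mY; rewrite setTI; exact: measurable_completion.
transitivity (\int[pushforward cmu (idfun : cT -> T)]_(x in D) f x).
  by rewrite (ge0_integral_pushforward mid)// => y; rewrite inE => /f0.
by apply: eq_measure_integral => A mA _; exact: completionE.
Qed.

Lemma integral_completion (D : set T) (f : T -> \bar R) :
  measurable D -> measurable_fun D f ->
  \int[cmu]_(x in D) f x = \int[mu]_(x in D) f x.
Proof.
move=> mD mf; rewrite [LHS]integralE [RHS]integralE; congr (_ - _).
  by apply: ge0_integral_completion => //; exact: measurable_funepos.
by apply: ge0_integral_completion => //; exact: measurable_funeneg.
Qed.

(** If the outer measure is infinite, the whole space works. Otherwise intersect countable covers
    whose measures exceed it by at most [k.+1%:R^-1]. *)
Lemma outer_measure_envelope (E : set T) :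
  exists F, [/\ measurable F, E `<=` F & mu F = (mu^*)%mu E].
Proof.
have [Eoo|Efin] := eqVneq ((mu^*)%mu E) +oo.
  exists setT; split => //; apply/eqP; rewrite Eoo -leye_eq -Eoo.
  by rewrite -(measurable_mu_extE mu measurableT); exact: le_mu_ext.
have E_fin : (mu^*)%mu E \is a fin_num.
  by rewrite ge0_fin_numE ?lt_neqAle ?Efin ?leey// mu_ext_ge0.
have cov k : exists A : (set T)^nat, [/\ forall i, measurable (A i),
    E `<=` \bigcup_i A i & mu (\bigcup_i A i) <= (mu^*)%mu E + (k.+1%:R^-1)%:E].
  have k0 : (0 < k.+1%:R^-1 :> R)%R by rewrite invr_gt0.
  have [_ [A [mA EA] <-] lt_A] := lb_ereal_inf_adherent k0 E_fin.
  exists A; split=> //; apply: le_trans (ltW lt_A).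
  by apply: measure_sigma_subadditive => //; exact: bigcupT_measurable.
have [A hA] := choice cov.
have mU k : measurable (\bigcup_i A k i).
  by have [? _ _] := hA k; exact: bigcupT_measurable.
have mF : measurable (\bigcap_k \bigcup_i A k i) by exact: bigcapT_measurable.
have EF : E `<=` \bigcap_k \bigcup_i A k i.
  by move=> x Ex k _; have [_ + _] := hA k; exact.
exists (\bigcap_k \bigcup_i A k i); split => //.
apply/eqP; rewrite eq_le; apply/andP; split; last first.
  by rewrite -(measurable_mu_extE mu mF); exact: le_mu_ext.
apply/lee_addgt0Pr => _/posnumP[e]; near \oo => n.
have [_ _ le_n] := hA n.
apply: (@le_trans _ _ (mu (\bigcup_i A n i))).
  by apply: le_measure; rewrite ?inE//; exact: bigcap_inf.
apply: (le_trans le_n); rewrite leeD// lee_fin ltW//.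
by near: n; apply: near_infty_natSinv_lt.
Unshelve. all: by end_near. Qed.

(** A null set of the completion has outer measure 0, so its envelope is a null set of the original
    sigma-algebra. *)
Lemma negligible_completion (A : set T) :
  cmu.-negligible A <-> mu.-negligible A.
Proof.
split=> -[N [mN N0 AN]]; last first.
  by exists N; split => //; [exact: measurable_completion|rewrite completionE].
have [F [mF NF F0]] := outer_measure_envelope N.
by exists F; split => //; [rewrite F0; exact: N0|exact: subset_trans NF].
Qed.

Hypothesis sfmu : sigma_finite setT mu.

(** Subtracting measures needs finiteness, so [E] is cut along the sigma-finite cover; each piece
    differs from its envelope by a null set, and countably many such errors are negligible. *)
Lemma completion_envelope (E : set T) : measurable (E : set cT) ->
  exists F, [/\ measurable F, E `<=` F & mu.-negligible (F `\` E)].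
Proof.
move=> mE; have [S TS hS] := sfmu.
have mES k : measurable (E `&` S k : set cT).
  by apply: measurableI => //; apply: measurable_completion; exact: (hS k).1.
have env k : exists F, [/\ measurable F, E `&` S k `<=` F &
    mu.-negligible (F `\` (E `&` S k))].
  have [F [mF EF muF]] := outer_measure_envelope (E `&` S k).
  exists F; split => //; apply/negligible_completion.
  have mF' := measurable_completion mF.
  apply/negligibleP; first exact: measurableD.
  have ltoo : cmu (E `&` S k) < +oo.
    apply: le_lt_trans (hS k).2; rewrite -(completionE (hS k).1).
    by apply: le_measure; rewrite ?inE//; apply: measurable_completion;
      exact: (hS k).1.
  have cF : cmu F = cmu (E `&` S k) := etrans (completionE mF) muF.
  have ltF : cmu F < +oo by rewrite cF.
  apply: etrans (measureD mF' (mES k) ltF) _; rewrite setIidr//.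
  apply: etrans (_ : cmu F - cmu (E `&` S k) = 0); first by [].
  by rewrite cF subee// ge0_fin_numE// measure_ge0.
have [F hF] := choice env.
exists (\bigcup_k F k); split.
- by apply: bigcupT_measurable => k; have [] := hF k.
- move=> x Ex; have : setT x by [].
  rewrite TS => -[k _ Sx]; exists k => //.
  by have [_ + _] := hF k; apply.
- apply: (@negligibleS _ _ _ _ (\bigcup_k (F k `\` (E `&` S k)))).
    by move=> x [[k _ Fx] Ex]; exists k => //; split => // -[].
  by apply: negligible_bigcup => k; have [] := hF k.
Qed.

(** The sublevel sets of [f] at rational heights are replaced by their envelopes; [N] collects the
    countably many null errors, and off [N] these sets determine [f]. *)
Lemma measurable_fun_completion_ae (D : set T) (f : T -> R) :
  measurable D -> measurable_fun (D : set cT) f ->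
  exists N, [/\ measurable N, mu N = 0 & measurable_fun (D `\` N) f].
Proof.
move=> mD mf; have mD' := measurable_completion mD.
(* An enumeration of the rationals; the default 0 at codes that decode to nothing only causes
   repetitions. *)
pose q (k : nat) : rat := odflt 0%R (unpickle k).
pose E k := D `&` f @^-1` `]-oo, ratr (q k)[%classic.
have env k : exists FN : set T * set T, [/\ measurable FN.1, measurable FN.2,
    mu FN.2 = 0 & E k `<=` FN.1 /\ FN.1 `\` E k `<=` FN.2].
  have mE : measurable (E k : set cT) by apply: mf => //; exact: measurable_itv.
  have [F [mF EF [N [mN N0 FN]]]] := completion_envelope mE.
  by exists (F, N).
have [FN hFN] := choice env.
have mN : measurable (\bigcup_k (FN k).2).
  by apply: bigcupT_measurable => k; have [] := hFN k.
exists (\bigcup_k (FN k).2); split => //.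
- apply: measure_negligible => //; apply: negligible_bigcup => k.
  by exists (FN k).2; have [_ ? ? _] := hFN k; split.
- apply: (measurability (@RGenInftyO.G R)); first exact: RGenInftyO.measurableE.
  move=> _ [_ [x ->] <-].
  (* By density, [f t < x] holds exactly when [f t] lies below some rational that is at most [x]. *)
  rewrite (_ : _ `&` _ = \bigcup_(k in [set k | (ratr (q k) <= x)%R])
      ((D `\` \bigcup_i (FN i).2) `&` (FN k).1)).
    apply: bigcup_measurable => k _; apply: measurableI.
      exact: measurableD.
    by have [] := hFN k.
  apply/seteqP; split => [t [[Dt Nt]]|t [k /= qkx [[Dt Nt] Ft]]].
    rewrite /= in_itv/= => ftx.
    have [r] := rat_in_itvoo ftx; rewrite in_itv/= => /andP[fr rx].
    have qr : q (pickle r) = r by rewrite /q pickleK.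
    exists (pickle r); first by rewrite /= qr ltW.
    split => //; have [_ _ _ [+ _]] := hFN (pickle r); apply.
    by split => //; rewrite /= in_itv/= qr.
  split=> //=; rewrite in_itv/=.
  have [_ _ _ [_ sub]] := hFN k.
  have [Et|nEt] := pselect (E k t).
    by case: Et => _; rewrite /= in_itv/= => /lt_le_trans; apply.
  by exfalso; apply: Nt; exists k => //; exact: sub.
Qed.

End completion.

(** * Symmetric kernels *)

Section kernel_op.
Context d (T : measurableType d) (R : realType).
Variable mu : {sigma_finite_measure set T -> \bar R}.
Variable k : T * T -> R.
Hypothesis mk : measurable_fun setT k.
Hypothesis k0 : forall p, (0 <= k p)%R.
Hypothesis ksym : forall x y, k (x, y) = k (y, x).
Local Open Scope ereal_scope.

Definition kernel_op (f : T -> R) (x : T) : \bar R :=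
  \int[mu]_y (k (x, y) * f y)%:E.

Let measurable_kf (f : T -> R) : measurable_fun setT f ->
  measurable_fun setT (fun p : T * T => (k p * f p.2)%:E).
Proof.
move=> mf; apply/measurable_EFinP; apply: measurable_funM => //.
exact: measurableT_comp.
Qed.

Let measurable_gkf (g f : T -> R) :
  measurable_fun setT g -> measurable_fun setT f ->
  measurable_fun setT (fun p : T * T => (g p.1 * (k p * f p.2))%:E).
Proof.
move=> mg mf; apply/measurable_EFinP; apply: measurable_funM => //.
  exact: measurableT_comp.
by apply/measurable_EFinP; exact: measurable_kf.
Qed.

Let measurable_section (f : T -> R) x : measurable_fun setT f ->
  measurable_fun setT (fun y => (k (x, y) * f y)%:E).
Proof.
move=> mf; exact: (measurable_fun_pair2 x (measurable_kf mf)).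
Qed.

Lemma measurable_kernel_op (f : T -> R) :
  measurable_fun setT f -> measurable_fun setT (kernel_op f).
Proof.
move=> mf; pose F p := (k p * f p.2)%:E.
have -> : kernel_op f = (fun x => \int[mu]_y F^\+ (x, y)) \-
    (fun x => \int[mu]_y F^\- (x, y)).
  apply/funext => x; rewrite /kernel_op integralE.
  by congr (_ - _); apply: eq_integral => y _; rewrite ?funeposE ?funenegE.
apply: emeasurable_funB; apply: measurable_fun_fubini_tonelli_F => //.
  by apply: measurable_funepos; exact: measurable_kf.
by apply: measurable_funeneg; exact: measurable_kf.
Qed.

Lemma kernel_op_ge0 (f : T -> R) x : (forall y, 0 <= f y)%R -> 0 <= kernel_op f x.
Proof. by move=> f0; apply: integral_ge0 => y _; rewrite lee_fin mulr_ge0. Qed.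

Lemma le_abs_kernel_op (f : T -> R) x : measurable_fun setT f ->
  `|kernel_op f x| <= kernel_op (fun y => `|f y|%R) x.
Proof.
move=> mf; apply: le_trans (le_abse_integral _ _ _) _ => //.
  exact: measurable_section.
rewrite le_eqVlt; apply/orP; left; apply/eqP; apply: eq_integral => y _.
by rewrite abse_EFin normrM (ger0_norm (k0 _)).
Qed.

(** Tonelli exchanges the two integrations, and the symmetry of [k] turns the inner one back into a
    potential. *)
Lemma ge0_kernel_op_dual (f g : T -> R) :
  measurable_fun setT f -> measurable_fun setT g ->
  (forall x, 0 <= f x)%R -> (forall x, 0 <= g x)%R ->
  \int[mu]_x ((g x)%:E * kernel_op f x) = \int[mu]_y ((f y)%:E * kernel_op g y).
Proof.
move=> mf mg f0 g0; pose F p := (g p.1 * (k p * f p.2))%:E.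
transitivity (\int[mu]_x \int[mu]_y F (x, y)).
  apply: eq_integral => x _; rewrite /kernel_op /F /=.
  rewrite -ge0_integralZl_EFin//; last exact: measurable_section.
  by move=> y _; rewrite lee_fin mulr_ge0.
rewrite fubini_tonelli; last first.
- by move=> p; rewrite lee_fin !mulr_ge0.
- exact: measurable_gkf.
apply: eq_integral => y _; rewrite /kernel_op /F /=.
rewrite -ge0_integralZl_EFin//; last exact: measurable_section.
  by apply: eq_integral => x _; rewrite ksym -EFinM; congr (_%:E); ring.
by move=> x _; rewrite lee_fin mulr_ge0.
Qed.

(* When [c = 0] the junk value of a divergent [kernel_op f x] is killed by the
   convention [0 * oo = 0]. *)
Let scaled_section (f : T -> R) (c : R) x : measurable_fun setT f ->
  mu.-integrable setT (fun y => (c * (k (x, y) * f y))%:E) ->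
  \int[mu]_y (c * (k (x, y) * f y))%:E = c%:E * kernel_op f x /\
  (c != 0%R -> kernel_op f x \is a fin_num).
Proof.
move=> mf ig; have [->|c0] := eqVneq c 0%R.
  split=> //; rewrite mul0e; under eq_integral do rewrite mul0r.
  exact: integral0.
have ik : mu.-integrable setT (fun y => (k (x, y) * f y)%:E).
  have := integrableZl measurableT c^-1 ig; apply: eq_integrable => // y _.
  by rewrite -EFinM mulKf.
split; last by move=> _; exact: integrable_fin_num.
under eq_integral do rewrite EFinM.
exact: integralZl.
Qed.

Section signed.
Variables f g : T -> R.
Hypothesis mf : measurable_fun setT f.
Hypothesis mg : measurable_fun setT g.
Hypothesis fg_fin :
  \int[mu]_x (`|g x|%:E * kernel_op (fun y => `|f y|%R) x) < +oo.

Let F p := (g p.1 * (k p * f p.2))%:E.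

Let integrable_F : (mu \x mu).-integrable setT F.
Proof.
apply/integrable12ltyP; first exact: measurable_gkf.
apply: le_lt_trans fg_fin; rewrite le_eqVlt; apply/orP; left; apply/eqP.
apply: eq_integral => x _; rewrite /kernel_op.
rewrite -ge0_integralZl_EFin//; last first.
- by apply: measurable_section; exact: measurableT_comp.
- by move=> y _; rewrite lee_fin mulr_ge0.
by apply: eq_integral => y _; rewrite /F /= !normrM (ger0_norm (k0 _)).
Qed.

(** Almost every section of the integrable function [F] is integrable; where [g x] is nonzero it can
    be divided out. *)
Lemma kernel_op_fin_num :
  {ae mu, forall x, g x != 0%R -> kernel_op f x \is a fin_num}.
Proof.
apply: filterS (ae_integrable1 integrable_F) => x ix.
by case: (@scaled_section f (g x) x mf ix).
Qed.

(** Fubini for [F]. The inner integrals factor as [scaled_section] only where the sections are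
    integrable, hence the equalities almost everywhere on both sides. *)
Lemma kernel_op_dual :
  \int[mu]_x ((g x)%:E * kernel_op f x) = \int[mu]_y ((f y)%:E * kernel_op g y).
Proof.
transitivity (\int[mu]_x \int[mu]_y F (x, y)).
  apply: ae_eq_integral => //.
  - apply: emeasurable_funM; last exact: measurable_kernel_op.
    exact/measurable_EFinP.
  - exact: (measurable_fubini_F integrable_F).
  - apply: filterS (ae_integrable1 integrable_F) => x ix _.
    by case: (@scaled_section f (g x) x mf ix).
rewrite (Fubini integrable_F); apply: ae_eq_integral => //.
- exact: (measurable_fubini_G integrable_F).
- apply: emeasurable_funM; last exact: measurable_kernel_op.
  exact/measurable_EFinP.
have FE x y : F (x, y) = (f y * (k (y, x) * g x))%:E.
  by rewrite /F /= ksym; congr (_%:E); ring.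
apply: filterS (ae_integrable2 integrable_F) => y iy _.
under eq_integral do rewrite FE.
apply: (@scaled_section g (f y) y mg _).1.
by apply: eq_integrable iy => // x _; rewrite FE.
Qed.

End signed.
End kernel_op.

(** * Lebesgue measure and the Riesz potential *)

Section rV_norm.
Context {R : realType} {n : nat}.
Implicit Types (x y v : 'rV[R]_n) (r : R).

Lemma rV_norm_leP v r : 0 <= r ->
  `|v| <= r <-> forall i, `|v ord0 i| <= r.
Proof.
move=> r0; rewrite [`|v|]mx_normrE; split=> [/bigmax_leP[_ h] i|h].
  exact: (h (ord0, i)).
by apply/bigmax_leP; split=> // -[i j] _ /=; rewrite (ord1 i).
Qed.

Lemma rV_coord_le v i : `|v ord0 i| <= `|v|.
Proof. by have /rV_norm_leP : `|v| <= `|v| by []; apply. Qed.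

Lemma rV_norm_le_enorm v : `|v| <= enorm v.
Proof.
apply/rV_norm_leP => [|i]; first exact: sqrtr_ge0.
rewrite -sqrtr_sqr ler_sqrt ?sumr_ge0// => [|j _]; last exact: sqr_ge0.
by rewrite (bigD1 i)//= lerDl sumr_ge0// => j _; exact: sqr_ge0.
Qed.

Lemma enorm_le_rV_norm v : enorm v <= n%:R * `|v|.
Proof.
have n0 : 0 <= n%:R * `|v| by rewrite mulr_ge0.
rewrite -(ger0_norm n0) -sqrtr_sqr ler_sqrt ?sqr_ge0//.
apply: (@le_trans _ _ (\sum_(i < n) `|v| ^+ 2)).
  apply: ler_sum => i _; rewrite -real_normK ?num_real//.
  by rewrite lerXn2r ?nnegrE//; exact: rV_coord_le.
rewrite sumr_const card_ord -[leLHS]mulr_natl exprMn ler_wpM2r ?sqr_ge0//.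
by rewrite -natrX ler_nat; case: n => // m; rewrite leq_pmulr.
Qed.

Lemma measurable_box (A : 'I_n -> set (measurableTypeR R)) :
  (forall i, measurable (A i)) ->
  measurable [set v : 'rV[R]_n | forall i, A i (v ord0 i)].
Proof.
move=> mA; rewrite (_ : [set _ | _] = \bigcap_(i in [set: 'I_n])
    ((fun v : 'rV[R]_n => v ord0 i) @^-1` A i)).
  apply: fin_bigcap_measurable => // i _.
  by rewrite -[X in measurable X]setTI; apply: measurable_coord => //; exact: mA.
by apply/seteqP; split => v /= h i => [_|]; exact: h.
Qed.

Lemma norm_ballE x r : 0 <= r -> [set y | `|x - y| <= r] =
  [set y | forall i, `[x ord0 i - r, x ord0 i + r]%classic (y ord0 i)].
Proof.
move=> r0; apply/seteqP; split => y /=.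
  move=> /(rV_norm_leP _ r0) h i; have := h i.
  by rewrite !mxE in_itv/= ler_norml => /andP[? ?]; apply/andP; split; lra.
move=> h; apply/(rV_norm_leP _ r0) => i; have := h i.
by rewrite !mxE in_itv/= ler_norml => /andP[? ?]; apply/andP; split; lra.
Qed.

Lemma measurable_norm_ball x r : 0 <= r -> measurable [set y | `|x - y| <= r].
Proof.
move=> r0; rewrite norm_ballE//.
apply: (measurable_box (A := fun i => `[x ord0 i - r, x ord0 i + r]%classic)) => i.
exact: measurable_itv.
Qed.

(** Balls of the max norm are boxes, whose volume is a product of lengths; this is why the Riesz
    kernel is estimated in [|x - y|] rather than in [enorm]. *)
Lemma lebesgue_rV_norm_ball x r : 0 <= r ->
  lebesgue_rV R n [set y | `|x - y| <= r] = ((2 * r) ^+ n)%:E.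
Proof.
move=> r0; rewrite norm_ballE//.
rewrite (lebesgue_rV_box (A := fun i => `[x ord0 i - r, x ord0 i + r]%classic)).
  under eq_bigr => i _.
    rewrite lebesgue_measure_itv/= lte_fin.
    have -> : (if x ord0 i - r < x ord0 i + r
      then ((x ord0 i + r)%:E - (x ord0 i - r)%:E)%E else 0%E) = (2 * r)%:E.
      case: ifPn => [_|]; first by rewrite -EFinD; congr (_%:E); lra.
      by rewrite -leNgt => h; congr (_%:E); lra.
    over.
  by rewrite prodEFin prodr_const card_ord.
by move=> i; exact: measurable_itv.
Qed.

(** The sigma-algebra is generated by the coordinates, so an open set has to be exhibited as a
    countable union of boxes: balls with rational centre and radius [k.+1%:R^-1]. *)
Lemma open_measurable_rV (U : set 'rV[R]_n) : open U -> measurable U.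
Proof.
move=> oU; pose C (p : 'rV[rat]_n * nat) : set 'rV[R]_n :=
  [set y | `|map_mx ratr p.1 - y| <= p.2.+1%:R^-1].
have -> : U = \bigcup_p (if pselect (C p `<=` U) then C p else set0).
  apply/seteqP; split => [x Ux|x [p _]]; last first.
    by case: pselect => // pU; exact: pU.
  have /nbhs_ballP[e /= e0] : nbhs x U by exact: open_nbhs_nbhs.
  rewrite -ball_normE => eU.
  have [k ke] : exists k, k.+1%:R^-1 < e / 2.
    near \oo => k; exists k; near: k.
    by have := near_infty_natSinv_lt (PosNum (divr_gt0 e0 (ltr0n R 2))).
  have k0 : 0 < k.+1%:R^-1 :> R by rewrite invr_gt0.
  have appr i : exists q : rat, `|ratr q - x ord0 i| <= k.+1%:R^-1.
    have /rat_in_itvoo[q] : x ord0 i < x ord0 i + k.+1%:R^-1 by rewrite ltrDl.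
    rewrite in_itv/= => /andP[/ltW xq /ltW qx]; exists q.
    by rewrite ler_norml lerBlDl qx andbT lerBrDl (le_trans _ xq)// gerBl ltW.
  have [q hq] := choice appr.
  have xq : `|map_mx ratr (\row_i q i) - x| <= k.+1%:R^-1.
    by apply/(rV_norm_leP _ (ltW k0)) => i; rewrite !mxE; exact: hq.
  have CU : C (\row_i q i, k) `<=` U.
    move=> y /= qy; apply: eU => /=.
    rewrite -(subrKA (map_mx ratr (\row_i q i))).
    apply: (le_lt_trans (ler_normD _ _)); rewrite distrC.
    by rewrite (splitr e) ltrD// (le_lt_trans _ ke).
  by exists (\row_i q i, k) => //; case: pselect.
apply: countable_bigcupT_measurable => [|p]; first exact: countableP.
have mC : measurable (C p) by apply: measurable_norm_ball; rewrite invr_ge0.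
case: pselect => h; [exact: mC|exact: measurable0].
Unshelve. all: by end_near. Qed.

Lemma closed_measurable_rV (F : set 'rV[R]_n) : closed F -> measurable F.
Proof.
by move=> cF; rewrite -(setCK F); apply: measurableC; apply: open_measurable_rV;
  exact: closed_openC.
Qed.

Lemma compact_measurable_rV (K : set 'rV[R]_n) : compact K -> measurable K.
Proof.
by move=> cK; apply: closed_measurable_rV; apply: compact_closed => //;
  exact: norm_hausdorff.
Qed.

Lemma bounded_setP (A : set 'rV[R]_n) : bounded_set A ->
  exists2 D, 0 < D & forall x, A x -> `|x| <= D.
Proof.
case=> M [Mreal hM]; exists (`|M| + 1); first by rewrite ltr_wpDl.
by move=> x Ax; apply: (hM (`|M| + 1)) => //; rewrite ltr_pwDr// ler_norm.
Qed.

Lemma bounded_lebesgue_rV_lty (A : set 'rV[R]_n) : measurable A ->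
  bounded_set A -> (lebesgue_rV R n A < +oo)%E.
Proof.
move=> mA /bounded_setP[D D0 AD].
apply: (@le_lt_trans _ _ (lebesgue_rV R n [set y | `|0 - y| <= D])).
  apply: le_measure; rewrite ?inE//; first by apply: measurable_norm_ball; exact: ltW.
  by move=> x /AD; rewrite /= sub0r normrN.
by rewrite lebesgue_rV_norm_ball ?ltW// ltry.
Qed.

Lemma lebesgue_rV_set1 (x : 'rV[R]_n) : (0 < n)%N -> lebesgue_rV R n [set x] = 0%E.
Proof.
move=> n0; have -> : [set x] = [set y | `|x - y| <= 0].
  apply/seteqP; split => y /=; first by move=> ->; rewrite subrr normr0.
  by rewrite normr_le0 subr_eq0 => /eqP.
by rewrite lebesgue_rV_norm_ball// mulr0 expr0n; case: n n0.
Qed.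

(* The truncated Riesz kernel is dominated by a geometric series of indicators
   of the balls of radius [r / 2 ^ k]. *)
Lemma riesz_potential_bounded (a r : R) : 0 <= a -> a < n%:R -> 0 < r ->
  exists2 M : R, 0 <= M & forall (x : 'rV[R]_n) (D : set 'rV[R]_n) (h : 'rV[R]_n -> R),
    measurable D -> measurable_fun D h ->
    (forall y, D y -> `|x - y| <= r /\ 0 <= h y <= (`|x - y| `^ a)^-1) ->
    (\int[lebesgue_rV R n]_(y in D) (h y)%:E <= M%:E)%E.
Proof.
move=> a0 an r0; pose rad k : R := r / 2 ^+ k.
have rad_gt0 k : 0 < rad k by rewrite divr_gt0// exprn_gt0.
(* [c k] is the value of the Riesz kernel at the inner radius of the [k]-th dyadic annulus. Halving
   the radius multiplies the kernel by [2 ^ a] and the volume by [2 ^ - n], so [rho < 1] is the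
   condition [a < n]. *)
pose c k := (rad k.+1 `^ a)^-1; pose rho : R := 2 `^ a / 2 ^+ n.
have c_ge0 k : 0 <= c k by rewrite invr_ge0 powR_ge0.
have rho0 : 0 < rho by rewrite divr_gt0 ?powR_gt0// exprn_gt0.
have rho1 : rho < 1.
  rewrite ltr_pdivrMr ?exprn_gt0// mul1r -powR_mulrn//.
  have na0 : 0 < n%:R - a by rewrite subr_gt0.
  have := @gt0_ltr_powR R _ na0 1 2; rewrite /= powR1 !nnegrE.
  rewrite powRB; last by rewrite pnatr_eq0 implybT.
  by rewrite ltr_pdivlMr ?powR_gt0// mul1r; apply => //; rewrite ltr1n.
pose A := 2 `^ a / r `^ a * (2 * r) ^+ n.
have cE k : c k * (2 * rad k) ^+ n = A * rho ^+ k.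
  have pk : (2 ^+ k.+1) `^ a = (2 `^ a) ^+ k.+1 :> R.
    elim: (k.+1) => [|j IH]; first by rewrite !expr0 powR1.
    by rewrite !exprS powRM ?exprn_ge0// IH.
  have powRV (t : R) : 0 <= t -> t^-1 `^ a = (t `^ a)^-1.
    by move=> t0; rewrite -powR_inv1// -powRrM mulN1r powRN.
  rewrite /c /A /rho /rad powRM ?(ltW r0)// ?invr_ge0 ?exprn_ge0//.
  rewrite powRV ?exprn_ge0// pk.
  have u2 : 2 `^ a != 0 :> R by rewrite gt_eqF ?powR_gt0.
  have ur : r `^ a != 0 by rewrite gt_eqF ?powR_gt0.
  have u2k : 2 ^+ k != 0 :> R by rewrite expf_neq0.
  have u2n : 2 ^+ n != 0 :> R by rewrite expf_neq0.
  rewrite [2 * (_ / _)]mulrA [(2 * r / _) ^+ n]exprMn [(_ / 2 ^+ n) ^+ k]exprMn.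
  rewrite !exprVn [(2 ^+ k) ^+ n]exprAC exprS.
  move: (2 ^+ n) u2n (r `^ a) ur (2 `^ a) u2 => p up q uq t ut.
  by field; rewrite uq ut !expf_neq0.
have A0 : 0 <= A by rewrite mulr_ge0 ?divr_ge0 ?powR_ge0 ?exprn_ge0// mulr_ge0 ?ltW.
(* The sum of the geometric series with terms [A * rho ^+ k]. *)
exists (A / (1 - rho)).
  by rewrite divr_ge0// subr_ge0 ltW.
move=> x D h mD mh hD; pose B k := [set y : 'rV[R]_n | `|x - y| <= rad k].
have mB k : measurable (B k) by apply: measurable_norm_ball; exact: ltW.
pose F k y := (c k * \1_(B k) y)%:E.
have mF k : measurable_fun D (F k).
  by apply/measurable_EFinP; apply: measurable_funM.
have F0 k y : D y -> (0 <= F k y)%E by rewrite lee_fin mulr_ge0.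
apply: (@le_trans _ _ (\int[lebesgue_rV R n]_(y in D) \sum_(0 <= k <oo) F k y)%E).
  apply: ge0_le_integral => //.
  - by move=> y /hD[_ /andP[]].
  - exact/measurable_EFinP.
  - by apply: ge0_emeasurable_sum => // k y Dy _; exact: F0.
  - move=> y /hD[xyr /andP[_ hy]].
    have [k hk] : exists k, ((h y)%:E <= F k y)%E.
      suff [k yk ck] : exists2 k, B k y & (`|x - y| `^ a)^-1 <= c k.
        by exists k; rewrite lee_fin indicE mem_set// mulr1 (le_trans hy).
      (* At the pole the conventions decide: for [a != 0] the bound is the inverse of 0, that is 0,
         and for [a = 0] all powers are 1. *)
      have [xy0|xy0] := eqVneq `|x - y| 0.
        exists 0%N; first by rewrite /B /= xy0 ltW.
        rewrite xy0; have [az|an0] := eqVneq a 0; first by rewrite /c az !powRr0.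
        by rewrite powR0// invr0.
      have xyp : 0 < `|x - y| by rewrite lt_neqAle eq_sym xy0 normr_ge0.
      have small : exists k, rad k.+1 < `|x - y|.
        near \oo => k; exists k; near: k.
        have := near_infty_natSinv_expn_lt (PosNum (divr_gt0 xyp r0)).
        apply: filterS => k /=; rewrite div1r ltr_pdivlMr// => h1.
        apply: le_lt_trans h1; rewrite /rad mulrC ler_pM2r// lef_pV2 ?posrE ?exprn_gt0//.
        by rewrite ler_weXn2l// ler1n.
      (* Minimality puts [y] in the ball of radius [rad k0]; for [k0 = 0] this is the assumption
         that [|x - y|] is at most [r]. *)
      have [k0 hk0 mink] := ex_minnP small.
      exists k0.
        rewrite /B /=; case: k0 hk0 mink => [|j] _ mink; first by rewrite /rad expr0 divr1.
        by rewrite leNgt; apply/negP => /mink; rewrite ltnn.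
      rewrite lef_pV2 ?posrE ?powR_gt0//; apply: ge0_ler_powR => //; rewrite ?nnegrE; exact: ltW.
    apply: (le_trans hk).
    have Fy0 i : (0 <= F i y)%E by rewrite lee_fin mulr_ge0.
    apply: le_trans (nneseries_lim_ge k.+1 (fun i _ _ => Fy0 i)).
    by rewrite big_nat_recr//= leeDr// sume_ge0.
rewrite integral_nneseries//.
apply: (@le_trans _ _ (\sum_(0 <= k <oo) (A * rho ^+ k)%:E)%E).
  apply: lee_nneseries => [k _ _|k _]; first by apply: integral_ge0 => y Dy; exact: F0.
  rewrite /F; under eq_integral do rewrite EFinM.
  rewrite ge0_integralZl_EFin//; last by apply/measurable_EFinP.
  rewrite integral_indic// -cE EFinM lee_wpmul2l ?lee_fin//.
  rewrite -(lebesgue_rV_norm_ball x) ?(ltW (rad_gt0 k))//.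
  by apply: le_measure; rewrite ?inE; [exact: measurableI|exact: mB|exact: subIsetl].
apply: lime_le.
  by apply: is_cvg_nneseries => k _ _; rewrite lee_fin mulr_ge0// exprn_ge0// ltW.
apply: nearW => m; rewrite sumEFin lee_fin big_mkord.
rewrite -mulr_sumr ler_pdivlMr ?subr_gt0// -mulrA ler_piMr// mulrC.
have -> : (1 - rho) * \sum_(i < m) rho ^+ i = 1 - rho ^+ m.
  by rewrite -opprB mulNr -subrX1 opprB.
by rewrite gerBl exprn_ge0// ltW.
Unshelve. all: by end_near. Qed.

End rV_norm.

(** * Distance to the boundary and the Green profile *)

Section boundary_distance.
Context {R : realType} {n : nat} (Omega : set 'rV[R]_n).
Hypothesis Oopen : open Omega.
Local Notation dist := (dist_bdry Omega).

Lemma bdry_not_mem z : bdry Omega z -> ~ Omega z.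
Proof. 
case=> _ nz Oz; apply: nz; move: z Oz.
by have : Omega `<=` Omega° by rewrite -open_subsetE.
Qed.

(** Without boundary points [Omega] is clopen, and so is its trace on a line through one of its
    points; by connectedness the whole line lies in [Omega], against boundedness. This secures the
    meaning of [dist_bdry], since the infimum of the empty set is 0 by convention. *)
Lemma bdry_neq0 : (0 < n)%N -> Omega !=set0 -> bounded_set Omega ->
  bdry Omega !=set0.
Proof.
move=> n0 [x0 Ox0] /bounded_setP[D D0 OD]; apply: contrapT => nb.
have clO : closure Omega `<=` Omega.
  move=> z cz; apply: contrapT => nOz; apply: nb; exists z; split => //.
  by move/interior_subset.
pose e : 'rV[R]_n := const_mx 1; pose g (t : R) := x0 + t *: e.
have cg : continuous g.
  move=> t; apply: cvgD; first exact: cvg_cst.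
  by apply: cvgZr_tmp; exact: cvg_id.
have oP : open (g @^-1` Omega) by apply: open_comp => // t _; exact: cg.
have cP : closed (g @^-1` Omega).
  by apply: preimage_closed => //; exact: clO.
have : g @^-1` Omega = setT.
  have /connected_intervalP : is_interval [set: R] by [].
  apply.
  - by exists 0; rewrite /g /= scale0r addr0.
  - by exists (g @^-1` Omega) => //; rewrite setTI.
  - by exists (g @^-1` Omega) => //; rewrite setTI.
move=> PT; have : (g @^-1` Omega) (D + `|x0| + 1) by rewrite PT.
move=> /OD; apply/negP; rewrite -ltNge.
pose i0 := Ordinal n0; apply: lt_le_trans (rV_coord_le _ i0).
rewrite !mxE mulr1; apply: lt_le_trans (ler_norm _).
have := rV_coord_le x0 i0; rewrite ler_norml => /andP[+ _].
lra.
Qed.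

Hypothesis bO : bdry Omega !=set0.

Lemma dist_bdry_le x z : bdry Omega z -> dist x <= enorm (x - z).
Proof.
move=> bz; apply: ge_inf; last by exists z.
by exists 0 => _ [y _ <-]; exact: sqrtr_ge0.
Qed.

(** The max norm is at most the Euclidean one, so a boundary point at Euclidean distance less than
    [e] would belong to the open set [Omega]. *)
Lemma dist_bdry_ge x e : (forall y, `|x - y| < e -> Omega y) -> e <= dist x.
Proof.
move=> xe; apply: lb_le_inf; first by case: bO => z bz; exists (enorm (x - z)), z.
move=> _ [z bz <-]; rewrite leNgt; apply/negP => xz.
apply: (bdry_not_mem bz); apply: xe.
exact: le_lt_trans (rV_norm_le_enorm _) xz.
Qed.

Lemma dist_bdry_lt x e : dist x < e -> exists2 z, bdry Omega z & enorm (x - z) < e.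
Proof.
move=> /inf_lt[|_ [z bz <-] xz]; last by exists z.
by case: bO => z bz; exists (enorm (x - z)), z.
Qed.

Lemma dist_bdry_ge0 x : 0 <= dist x.
Proof.
apply: lb_le_inf; first by case: bO => z bz; exists (enorm (x - z)), z.
by move=> _ [z _ <-]; exact: sqrtr_ge0.
Qed.

Lemma dist_bdry_gt0 x : Omega x -> 0 < dist x.
Proof.
move=> Ox; have /nbhs_ballP[e /= e0] : nbhs x Omega by exact: open_nbhs_nbhs.
by rewrite -ball_normE => eO; apply: lt_le_trans e0 _; exact: dist_bdry_ge.
Qed.

(** If the ball of radius [r] around [x] lies in [Omega], then every [e < r / 2] serves all points
    within [r / 2] of [x]; compactness makes the choice uniform. *)
Lemma compact_thickening (K : set 'rV[R]_n) : compact K -> K `<=` Omega ->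
  exists2 e, 0 < e & forall x y, K x -> `|x - y| < e -> Omega y.
Proof.
move=> /compact_near_coveringP cK KO.
have : \forall e \near 0^'+, K `<=` (fun x => forall y, `|x - y| < e -> Omega y).
  apply: (cK R (0^'+)%R (fun e x => forall y, `|x - y| < e -> Omega y)) => x Kx.
  have /nbhs_ballP[r /= r0] : nbhs x Omega by apply: open_nbhs_nbhs; split => //; exact: KO.
  rewrite -ball_normE => rO.
  have r2 : 0 < r / 2 by rewrite divr_gt0.
  exists (ball x (r / 2), [set e | e < r / 2]).
    split; first by exact: nbhsx_ballx.
    exact: nbhs_right_lt.
  move=> [x' e] [/= + er] y x'y; rewrite -ball_normE /= => xx'.
  apply: rO => /=; rewrite -(subrKA x') (le_lt_trans (ler_normD _ _))//.
  by rewrite (splitr r) ltrD// (lt_trans x'y).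
move=> h; have [e [e0 he]] : exists e : R, 0 < e /\
    K `<=` (fun x => forall y, `|x - y| < e -> Omega y).
  near (0 : R)^'+ => e; exists e; split => //.
  by near: e.
by exists e => // x y /he; apply.
Unshelve. all: by end_near. Qed.

End boundary_distance.

Section green_profile.
Context {R : realType} {n : nat} (Omega : set 'rV[R]_n) (s gamma : R).
Hypotheses (s0 : 0 < s) (sn : 2 * s <= n%:R) (gamma0 : 0 < gamma).
Hypotheses (Oopen : open Omega) (Obounded : bounded_set Omega).
Hypothesis bO : bdry Omega !=set0.
Local Notation dist := (dist_bdry Omega).
Local Notation profile := (green_profile s gamma Omega).
Let a : R := n%:R - 2 * s.
Let a0 : 0 <= a. Proof. by rewrite subr_ge0. Qed.

Lemma green_profile_ge0 x y : 0 <= profile x y.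
Proof. by rewrite mulr_ge0// ?invr_ge0 powR_ge0. Qed.

(** A value by convention: division by 0 gives 0, and so does raising 0 to the nonzero power
    [gamma]. It lets the bounds below hold on the diagonal too. *)
Lemma green_profilexx x : profile x x = 0.
Proof.
rewrite /green_profile subrr.
have -> : enorm (0 : 'rV[R]_n) = 0.
  rewrite /enorm big1 ?sqrtr0// => i _; by rewrite mxE expr0n.
rewrite expr0n invr0 mulr0 min_l// [X in _ * X]powR0 ?mulr0//.
by rewrite gt_eqF.
Qed.

(** The minimum is bounded by 1, and the smaller max norm replaces the Euclidean one in the
    denominator. *)
Lemma green_profile_le_riesz x y : profile x y <= (`|x - y| `^ a)^-1.
Proof.
have [<-|xy] := eqVneq x y; first by rewrite green_profilexx invr_ge0 powR_ge0.
have nxy : 0 < `|x - y| by rewrite normr_gt0 subr_eq0.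
have exy := lt_le_trans nxy (rV_norm_le_enorm _).
apply: (@le_trans _ _ ((enorm (x - y) `^ a)^-1 * 1)).
  rewrite ler_wpM2l ?invr_ge0 ?powR_ge0//.
  have {2}<- : 1 `^ gamma = 1 :> R by rewrite powR1.
  apply: ge0_ler_powR; rewrite ?nnegrE ?ler01 ?(ltW gamma0)//.
    by rewrite le_min ler01 andbT divr_ge0 ?mulr_ge0 ?dist_bdry_ge0 ?exprn_ge0// ltW.
  by rewrite ge_min lexx orbT.
rewrite mulr1 lef_pV2 ?posrE ?powR_gt0//; apply: ge0_ler_powR => //.
- by rewrite nnegrE.
- by rewrite nnegrE ltW.
- exact: rV_norm_le_enorm.
Qed.

(** Here the minimum is bounded by its first argument, which supplies the factor [dist y] to the
    power [gamma]. *)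
Lemma green_profile_le_far (r D : R) x y : 0 < r -> r <= `|x - y| -> dist x <= D ->
  profile x y <= (r `^ a)^-1 * (D / r ^+ 2) `^ gamma * dist y `^ gamma.
Proof.
move=> r0 rxy xD; have re := le_trans rxy (rV_norm_le_enorm _).
have e0 := lt_le_trans r0 re.
have dx := dist_bdry_ge0 bO x; have dy := dist_bdry_ge0 bO y.
have D0 : 0 <= D := le_trans dx xD.
rewrite /green_profile -[leRHS]mulrA -powRM ?divr_ge0 ?exprn_ge0 ?(ltW r0)//.
apply: ler_pM; rewrite ?invr_ge0 ?powR_ge0//.
  rewrite lef_pV2 ?posrE ?powR_gt0//; apply: ge0_ler_powR => //; by rewrite nnegrE ltW.
apply: ge0_ler_powR; rewrite ?nnegrE ?(ltW gamma0)//.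
- by rewrite le_min ler01 andbT divr_ge0 ?mulr_ge0 ?exprn_ge0// ltW.
- by rewrite mulr_ge0// divr_ge0// exprn_ge0// ltW.
rewrite ge_min; apply/orP; left; rewrite [leRHS]mulrAC.
apply: ler_pM; rewrite ?mulr_ge0 ?invr_ge0 ?exprn_ge0// ?(ltW e0)//.
  exact: ler_wpM2r.
by rewrite lef_pV2 ?posrE ?exprn_gt0// lerXn2r ?nnegrE ?(ltW r0) ?(ltW e0).
Qed.

(** If [dist y] is at least [e / 2], the weight is bounded below and the Riesz potential is bounded.
    If it is smaller, [y] stays at distance at least [e / 2] from [K] and the far estimate applies.
    The two resulting constants are added. *)
Lemma green_profile_integral_le (K : set 'rV[R]_n) (A : R) :
  0 < A -> compact K -> K `<=` Omega ->
  exists2 C, 0 <= C & forall y (h : 'rV[R]_n -> R), Omega y ->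
    measurable_fun K h -> (forall x, K x -> 0 <= h x <= A * profile x y) ->
    (\int[lebesgue_rV R n]_(x in K) (h x)%:E <= (C * dist y `^ gamma)%:E)%E.
Proof.
move=> A0 cK KO; have mK := compact_measurable_rV cK.
have [e e0 eK] := compact_thickening Oopen cK KO.
have [D D0 OD] := bounded_setP Obounded; have [z bz] := bO.
(* Bounds [dist] on [Omega] through the distance to the fixed boundary point [z]. *)
pose L : R := n%:R * (D + `|z|).
have dL x : Omega x -> dist x <= L.
  move=> /OD xD; apply: le_trans (dist_bdry_le x bz) _.
  apply: (le_trans (enorm_le_rV_norm _)); rewrite ler_wpM2l//.
  by rewrite (le_trans (ler_normB _ _))// lerD2r.
have L0 : 0 <= L by rewrite mulr_ge0// addr_ge0// ltW.
have an : a < n%:R by rewrite gtrBl mulr_gt0.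
have DD0 : 0 < D + D by rewrite addr_gt0.
(* Two points of [Omega] are at distance at most [D + D], so the truncation radius loses nothing. *)
have [M M0 hM] := @riesz_potential_bounded R n a (D + D) a0 an DD0.
have e20 : 0 < e / 2 by rewrite divr_gt0.
have muK : (lebesgue_rV R n K < +oo)%E.
  by apply: bounded_lebesgue_rV_lty => //; exact: compact_bounded.
pose B := ((e / 2) `^ a)^-1 * (L / (e / 2) ^+ 2) `^ gamma.
pose v := fine (lebesgue_rV R n K).
have B0 : 0 <= B by rewrite mulr_ge0// ?invr_ge0 powR_ge0.
have v0 : 0 <= v by rewrite fine_ge0.
have eg0 : 0 < (e / 2) `^ gamma by rewrite powR_gt0.
have C1 : 0 <= A * M / (e / 2) `^ gamma by rewrite divr_ge0 ?powR_ge0// mulr_ge0// ltW.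
have C2 : 0 <= A * B * v by rewrite mulr_ge0// mulr_ge0// ltW.
exists (A * M / (e / 2) `^ gamma + A * B * v); first exact: addr_ge0.
move=> y h Oy mh hK; have [ye|ye] := leP (e / 2) (dist y).
  apply: (@le_trans _ _ (A * M)%:E).
    have mAh : measurable_fun K (fun x => A^-1 * h x) by exact: measurable_funM.
    rewrite (_ : \int[_]_(x in K) _ = \int[lebesgue_rV R n]_(x in K)
        (A%:E * (A^-1 * h x)%:E))%E; last first.
      by apply: eq_integral => x _; rewrite -EFinM mulVKf// gt_eqF.
    rewrite ge0_integralZl_EFin ?(ltW A0)//; last 2 first.
    - by move=> x /hK /andP[? _]; rewrite lee_fin mulr_ge0// invr_ge0 ltW.
    - exact/measurable_EFinP.
    rewrite EFinM lee_wpmul2l ?lee_fin ?(ltW A0)//.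
    apply: (hM y) => // x Kx; have /andP[h0 hA] := hK _ Kx; split.
      by rewrite (le_trans (ler_normB _ _))// lerD ?OD//; exact: KO.
    rewrite mulr_ge0 ?invr_ge0 ?(ltW A0)//= mulrC ler_pdivrMr// mulrC.
    apply: (le_trans hA); rewrite ler_pM2l// distrC; exact: green_profile_le_riesz.
  rewrite lee_fin mulrDl -[leLHS]addr0 lerD//; last by rewrite mulr_ge0// powR_ge0.
  have AM0 : 0 <= A * M by rewrite mulr_ge0// ltW.
  rewrite -[leRHS]mulrA ler_peMr//.
  rewrite mulrC ler_pdivlMr// mul1r.
  apply: ge0_ler_powR; rewrite ?nnegrE ?(ltW gamma0) ?(ltW e20)//.
  exact: dist_bdry_ge0.
have far x : K x -> h x <= A * B * dist y `^ gamma.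
  move=> Kx; have /andP[_ hA] := hK _ Kx; apply: (le_trans hA).
  rewrite -mulrA ler_pM2l//; apply: green_profile_le_far => //; last exact/dL/KO.
  (* If [x] in [K] were within [e / 2] of [y], the boundary point [w] would be within [e] of [x],
     hence in [Omega]. *)
  have [w bw yw] := dist_bdry_lt bO ye.
  rewrite leNgt; apply/negP => xy; apply: (bdry_not_mem Oopen bw).
  apply: (eK x) => //; rewrite -(subrKA y) (le_lt_trans (ler_normD _ _))//.
  by rewrite (splitr e) ltrD// (le_lt_trans (rV_norm_le_enorm _)).
apply: (@le_trans _ _ (\int[lebesgue_rV R n]_(x in K) (A * B * dist y `^ gamma)%:E)%E).
  apply: ge0_le_integral => //.
  - by move=> x /hK /andP[].
  - exact/measurable_EFinP.
have -> : (\int[lebesgue_rV R n]_(x in K) (A * B * dist y `^ gamma)%:E =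
    (A * B * dist y `^ gamma)%:E * (v%:E))%E.
  by rewrite /v fineK ?ge0_fin_numE//; exact: integral_cst.
by rewrite -EFinM lee_fin mulrAC mulrDl lerDr mulr_ge0// powR_ge0.
Qed.

End green_profile.

(** * Borel versions *)

Section product_null_sets.
Context d (T : measurableType d) (R : realType).
Variable mu : {sigma_finite_measure set T -> \bar R}.
Local Open Scope ereal_scope.

(** The reflected measure has the same values on rectangles, and these determine the product
    measure. *)
Lemma product_measure_swap (N : set (T * T)) : measurable N ->
  (mu \x mu) (unstable.swap @^-1` N) = (mu \x mu) N.
Proof.
move=> mN; have mswap := @measurable_swap _ _ T T.
have mB := isMeasurableFun.Build _ _ _ _ _ mswap.
rewrite [RHS](product_measure_unique (m' := pushforward (mu \x mu) unstable.swap))//.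
move=> A B mA mB' /=; rewrite /pushforward.
have -> : unstable.swap @^-1` (A `*` B) = B `*` A.
  by apply/seteqP; split => -[x y] /= [].
by rewrite product_measure1E// muleC.
Qed.

Lemma ae_xsection_null (N : set (T * T)) : measurable N -> (mu \x mu) N = 0 ->
  {ae mu, forall x, mu (xsection N x) = 0}.
Proof.
move=> mN N0; have mf := measurable_fun_xsection mu mN.
have /(ae_eq_integral_abs mu measurableT mf) : \int[mu]_x `|mu (xsection N x)| = 0.
  by rewrite -[RHS]N0; apply: eq_integral => x _; rewrite gee0_abs.
by apply: filterS => x /(_ I).
Qed.

End product_null_sets.

Section borel_representatives.
Context d (T : measurableType d) (R : realType).
Variable mu : {sigma_finite_measure set T -> \bar R}.
Variable Omega : set T.
Hypothesis mO : measurable Omega.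
Local Open Scope ereal_scope.
Local Notation cT := (completionType mu).
Local Notation cmu := (completion mu).

Let sf_mu : sigma_finite setT mu := sigma_finiteT mu.

Lemma sigma_finite_product : sigma_finite setT (mu \x mu).
Proof.
have /sigma_finiteP[F [TF ndF Foo]] := sf_mu.
exists (fun k => F k `*` F k).
  apply/esym; rewrite -subTset => -[x y] _.
  have : [set: T] x by []. have : [set: T] y by [].
  rewrite TF => -[i _ Fi] [j _ Fj]; exists (maxn i j) => //; split => /=.
  - by move: Fj; exact/subsetPset/ndF/leq_maxr.
  - by move: Fi; exact/subsetPset/ndF/leq_maxl.
move=> k; have [mF Fk] := Foo k; split; first exact: measurableX.
by rewrite product_measure1E// lte_mul_pinfty// ge0_fin_numE.
Qed.

Lemma ae_completionP (P : T -> Prop) :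
  {ae cmu, forall x, P x} <-> {ae mu, forall x, P x}.
Proof. exact: negligible_completion. Qed.

(** The second clause holds at every point: it makes [psi0] vanish outside [Omega] and carries
    bounds and supports over from [psi] without exceptional sets. *)
Definition borel_version (psi psi0 : T -> R) :=
  [/\ measurable_fun setT psi0,
      forall x, psi0 x = 0%R \/ Omega x /\ psi0 x = psi x &
      {ae mu, forall x, Omega x -> psi0 x = psi x}].

Lemma exists_borel_version (psi : T -> R) :
  measurable_fun (Omega : set cT) psi -> exists psi0, borel_version psi psi0.
Proof.
move=> mpsi.
have [N [mN N0 mpsiN]] := measurable_fun_completion_ae sf_mu mO mpsi.
have mON : measurable (Omega `\` N) by exact: measurableD.
exists (psi \_ (Omega `\` N)); split.
- by apply/(measurable_restrictT _ mON).
- move=> x; rewrite patchE; case: ifPn => [|_]; last by left.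
  by rewrite inE => -[Ox _]; right.
- exists N; split => // x /= h; apply: contrapT => Nx; apply: h => Ox.
  by rewrite patchE mem_set//; split.
Qed.

(** [F] is only controlled up to a null set; completeness of [cmu] makes it measurable, and the
    integral of [F0] does not see the completion. *)
Lemma integral_borel_version (F F0 : T -> \bar R) :
  measurable_fun setT F0 -> (forall x, ~ Omega x -> F0 x = 0) ->
  {ae mu, forall x, Omega x -> F x = F0 x} ->
  \int[cmu]_(x in Omega) F x = \int[mu]_x F0 x /\
  measurable_fun (Omega : set cT) F.
Proof.
move=> mF0 F00 FF0.
have mO' := measurable_completion mu mO.
have mF0' : measurable_fun (Omega : set cT) F0.
  by apply: measurable_fun_completion => //; exact: measurable_funTS.
have mF : measurable_fun (Omega : set cT) F.
  apply: (ae_measurable_fun (@completion_complete _ _ _ mu) _ mF0').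
  by apply/ae_completionP; apply: filterS FF0 => x /[apply] ->.
split=> //; transitivity (\int[cmu]_(x in Omega) F0 x).
  by apply: ae_eq_integral => //; apply/ae_completionP.
rewrite integral_completion//; last exact: measurable_funTS.
rewrite integral_mkcond; apply: eq_integral => x _.
by rewrite patchE; case: ifPn => // /negP; rewrite inE => /F00.
Qed.

Variables (g : T -> T -> R) (k : T * T -> R).

(** Agreement with [g] is stated section by section, as the Green operator integrates [g x] for
    fixed [x]. The version vanishes on the diagonal, where the Green kernel is not controlled. *)
Definition borel_kernel :=
  [/\ measurable_fun setT k, forall x y, k (x, y) = k (y, x),
      forall x y, k (x, y) = 0%R \/ [/\ Omega x, Omega y, x <> y & k (x, y) = g x y] &
      {ae mu, forall x, Omega x -> {ae mu, forall y, Omega y -> k (x, y) = g x y}}].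

Hypothesis bk : borel_kernel.

Lemma integral_kernel_op (psi psi0 : T -> R) : borel_version psi psi0 ->
  {ae mu, forall x, Omega x ->
    \int[cmu]_(y in Omega) (g x y * psi y)%:E = kernel_op mu k psi0 x}.
Proof.
move=> [mpsi0 psi00 psi0E]; have [mk ksym k00 kE] := bk.
apply: filterS kE => x hx Ox.
have [] // := @integral_borel_version (fun y => (g x y * psi y)%:E)
  (fun y => (k (x, y) * psi0 y)%:E).
- apply/measurable_EFinP; apply: measurable_funM => //.
  exact: (measurable_fun_pair2 x mk).
- by move=> y nOy; case: (psi00 y) => [->|[]//]; rewrite mulr0.
- apply: filterS2 (hx Ox) psi0E => y h1 h2 Oy.
  by rewrite h1// h2.
Qed.

End borel_representatives.

(** The kernel is set to 0 on the exceptional set [N], on its reflection to preserve symmetry, and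
    on the diagonal. Almost all sections of this set are null, those of the diagonal because points
    are null. *)
Lemma exists_borel_kernel d (T : measurableType d) (R : realType)
    (mu : {sigma_finite_measure set T -> \bar R}) (Omega : set T) (g : T -> T -> R) :
  measurable Omega ->
  measurable [set p : T * T | p.1 = p.2] -> (forall x, mu [set x] = 0%E) ->
  measurable_fun (Omega `*` Omega : set (completionType (mu \x mu)%E))
    (fun p : T * T => g p.1 p.2) ->
  (forall x y, Omega x -> Omega y -> g x y = g y x) ->
  exists k, borel_kernel mu Omega g k.
Proof.
move=> mO mdiag mu1 mg gsym.
have mOO : measurable (Omega `*` Omega) by exact: measurableX.
have [N [mN N0 mgN]] := measurable_fun_completion_ae (sigma_finite_product mu) mOO mg.
have msN : measurable (unstable.swap @^-1` N).
  by rewrite -[X in measurable X]setTI; apply: measurable_swap.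
pose N' := N `|` unstable.swap @^-1` N `|` [set p : T * T | p.1 = p.2].
have mN' : measurable N' by apply: measurableU => //; exact: measurableU.
have N'0 : {ae mu, forall x, mu (xsection N' x) = 0%E}.
  have sN0 : (mu \x mu)%E (unstable.swap @^-1` N) = 0%E by rewrite product_measure_swap.
  apply: filterS2 (ae_xsection_null mN N0) (ae_xsection_null msN sN0) => x h1 h2.
  apply: measure_negligible; first exact: measurable_xsection.
  apply: (@negligibleS _ _ _ _
    (xsection N x `|` xsection (unstable.swap @^-1` N) x `|` [set x])).
    move=> y; rewrite /xsection /= inE => -[[Ny|Ny]|/= <-]; last by right.
      by left; left; rewrite /= inE.
    by left; right; rewrite /= inE.
  apply: negligibleU; first apply: negligibleU.
  - by apply/negligibleP => //; exact: measurable_xsection.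
  - by apply/negligibleP => //; exact: measurable_xsection.
  - exists [set x]; split; [|exact: mu1|by []].
    have := measurable_xsection x mdiag; congr measurable.
    by apply/seteqP; split => y; rewrite /xsection /= inE.
pose W := (Omega `*` Omega) `\` N'.
have mW : measurable W by exact: measurableD.
have Wsym x y : W (x, y) -> W (y, x).
  move=> [[/= Ox Oy] nN]; split; first by split.
  by move=> [[Nyx|Nxy]|/= yx]; apply: nN; [left; right|left; left|right].
exists ((fun p : T * T => g p.1 p.2) \_ W); split.
- apply/(measurable_restrictT _ mW); apply: measurable_funS mgN.
    exact: measurableD.
  by move=> p [Op nN]; split => // Np; apply: nN; left; left.
- move=> x y; rewrite !patchE /=.
  have [Wxy|nWxy] := pselect (W (x, y)).
    by rewrite !mem_set//; [case: Wxy => -[] *; exact: gsym|exact: Wsym].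
  by rewrite !memNset// => /Wsym.
- move=> x y; rewrite patchE; case: ifPn => [|_]; last by left.
  rewrite inE => -[[/= Ox Oy] nN]; right; split => // xy; apply: nN.
  by right.
- apply: filterS N'0 => x hx Ox; exists (xsection N' x); split => //.
    exact: measurable_xsection.
  move=> y /= h; rewrite /xsection /= inE; apply: contrapT => nN; apply: h => Oy.
  by rewrite patchE mem_set//; split.
Qed.

(** * Compact exhaustion of an open set, and measurability of the diagonal *)

Lemma compact_exhaustion (R : realType) n (Omega : set 'rV[R]_n) : open Omega ->
  exists K : (set 'rV[R]_n)^nat, [/\ forall m, compact (K m),
    forall m, K m `<=` Omega & Omega `<=` \bigcup_m K m].
Proof.
(* The distance to the complement is kept at least [m.+1%:R^-1], which is positive even for [m = 0];
   this forces [K m] into [Omega]. *)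
move=> oO; pose K m := [set x : 'rV[R]_n | `|x| <= m%:R /\
  forall y, ~ Omega y -> m.+1%:R^-1 <= `|x - y|].
exists K; split.
- move=> m; apply: bounded_closed_compact.
    exists m%:R; split => // M mM x [xm _]; exact: le_trans xm (ltW mM).
  have -> : K m = [set x | `|x| <= m%:R] `&`
      \bigcap_(y in ~` Omega) [set x | m.+1%:R^-1 <= `|x - y|].
    by apply/seteqP; split => x [? h]; split.
  apply: closedI.
    have cle : closed [set r : R | r <= m%:R] by exact: closed_le.
    apply: (@preimage_closed _ _ (fun x : 'rV[R]_n => `|x|) _ _ cle).
    by move=> x _; exact: norm_continuous.
  apply: closed_bigI => y _.
  have cge : closed [set r : R | m.+1%:R^-1 <= r] by exact: closed_ge.
  apply: (@preimage_closed _ _ (fun x : 'rV[R]_n => `|x - y|) _ _ cge).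
  have csub : continuous (fun x : 'rV[R]_n => x - y).
    move=> x; apply: cvgB; [exact: (nbhs_filter x)|exact: cvg_id|].
    exact: (@cvg_cst _ _ _ (nbhs x) (nbhs_filter x)).
  by move=> x _; apply: continuous_comp; [exact: csub|exact: norm_continuous].
- move=> m x [_ h]; apply: contrapT => /h; rewrite subrr normr0.
  by apply/negP; rewrite -ltNge.
- move=> x Ox; have /nbhs_ballP[e /= e0] : nbhs x Omega by exact: open_nbhs_nbhs.
  rewrite -ball_normE => eO; near \oo => m; exists m => //; split.
    near: m; exact: nbhs_infty_ger.
  move=> y nOy; rewrite leNgt; apply/negP => xy; apply: nOy; apply: eO => /=.
  apply: (lt_trans xy); near: m.
  by have := near_infty_natSinv_lt (PosNum e0).
Unshelve. all: by end_near. Qed.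

Lemma measurable_diag_rV (R : realType) n :
  measurable [set p : 'rV[R]_n * 'rV[R]_n | p.1 = p.2].
Proof.
have -> : [set p : 'rV[R]_n * 'rV[R]_n | p.1 = p.2] = \bigcap_(i in [set: 'I_n])
    ((fun p : 'rV[R]_n * 'rV[R]_n => p.1 ord0 i - p.2 ord0 i) @^-1` [set 0]).
  apply/seteqP; split => p /= h; first by move=> i _ /=; rewrite h subrr.
  by apply/rowP => i; apply/eqP; rewrite -subr_eq0; apply/eqP; exact: (h i I).
apply: fin_bigcap_measurable => // i _; rewrite -[X in measurable X]setTI.
have mi := @measurable_coord R n i; have mf : measurable_fun setT
    (fun p : 'rV[R]_n * 'rV[R]_n => p.1 ord0 i - p.2 ord0 i).
  apply: measurable_funB.
    exact: (measurableT_comp mi measurable_fst).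
  exact: (measurableT_comp mi measurable_snd).
by apply: mf.
Qed.

(** * The potential of f *)

Section potential.
Context {R : realType} {n : nat} (Omega : set 'rV[R]_n).
Variables (G : 'rV[R]_n -> 'rV[R]_n -> R) (k : 'rV[R]_n * 'rV[R]_n -> R).
Variables (w f f0 : 'rV[R]_n -> R).
Local Notation mu := (lebesgue_rV R n).
Local Notation lam := (lebesgue R n).
Local Open Scope ereal_scope.
Hypothesis oO : open Omega.
Hypothesis k0 : forall p, (0 <= k p)%R.
Hypothesis bk : borel_kernel mu Omega G k.
Hypothesis bf : borel_version mu Omega f f0.
Hypothesis w_gt0 : forall x, Omega x -> (0 < w x)%R.
Hypothesis fw_int : lam.-integrable Omega (fun x => (f x * w x)%:E).
(** [w] stands for [dist_bdry Omega] to the power [gamma]; the profile estimate enters this section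
    only through this bound. *)
Hypothesis kK : forall K, compact K -> K `<=` Omega ->
  exists2 C, (0 <= C)%R &
    forall y, Omega y -> kernel_op mu k \1_K y <= (C * w y)%:E.

Let mO : measurable Omega := open_measurable_rV oO.
Let mO' := measurable_completion mu mO.
Let mk : measurable_fun setT k. Proof. by case: bk. Qed.
Let ksym x y : k (x, y) = k (y, x). Proof. by case: bk. Qed.
Let mf0 : measurable_fun setT f0. Proof. by case: bf. Qed.
Let absf0 (y : 'rV[R]_n) : R := `|f0 y|%R.
Let mabsf0 : measurable_fun setT absf0. Proof. exact: measurableT_comp. Qed.

Let f0_out x : ~ Omega x -> f0 x = 0%R.
Proof. by case: bf => _ + _ => /(_ x)[//|[]]. Qed.

Let absf0_ge0 y : (0 <= absf0 y)%R. Proof. exact: normr_ge0. Qed.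

Let kernel_op_absf0_ge0 x : 0 <= kernel_op mu k absf0 x.
Proof. exact: kernel_op_ge0. Qed.

(** Duality moves the kernel from [|f0|] to [\1_K]. The constant is arbitrary and its bound holds
    almost everywhere, so that the lemma serves both for local integrability and, with the essential
    supremum, for the final estimate. *)
Lemma potential_le (K : set 'rV[R]_n) (c : R) : (0 <= c)%R -> measurable K ->
  {ae mu, forall y, Omega y -> kernel_op mu k \1_K y <= (c * w y)%:E} ->
  \int[mu]_(x in K) kernel_op mu k absf0 x <=
    c%:E * \int[lam]_(y in Omega) `|(f y * w y)%:E|.
Proof.
move=> c0 mK hK; have m1K : measurable_fun setT (\1_K : 'rV[R]_n -> R).
  exact: measurable_indic.
have mkf := measurable_kernel_op mu mk mabsf0.
have -> : \int[mu]_(x in K) kernel_op mu k absf0 x =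
    \int[mu]_x ((\1_K x)%:E * kernel_op mu k absf0 x).
  rewrite integral_mkcond; apply: eq_integral => x _.
  by rewrite patchE indicE; case: ifPn => _; rewrite ?mul1e ?mul0e.
rewrite ge0_kernel_op_dual//.
pose F y := (absf0 y)%:E * kernel_op mu k \1_K y.
have mF : measurable_fun setT F.
  by apply: emeasurable_funM; [exact/measurable_EFinP|exact: measurable_kernel_op].
have F0 y : 0 <= F y by apply: mule_ge0; rewrite ?lee_fin//; exact: kernel_op_ge0.
have [<- mFO] : \int[lam]_(y in Omega) F y = \int[mu]_y F y /\
    measurable_fun (Omega : set (completionType mu)) F.
  apply: integral_borel_version => //; last exact: aeW.
  by move=> x nOx; rewrite /F /absf0 f0_out// normr0 mul0e.
have mfw := measurable_int _ fw_int.
rewrite -ge0_integralZl_EFin//; last exact: measurableT_comp.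
apply: ae_ge0_le_integral => //.
- by move=> x _; rewrite mule_ge0.
- by apply: emeasurable_funM => //; exact: measurableT_comp.
- have [_ _ f0E] := bf.
  apply/ae_completionP; apply: filterS2 hK f0E => y h1 h2 Oy.
  rewrite /F /absf0 h2// abse_EFin normrM (ger0_norm (ltW (w_gt0 Oy))) -EFinM.
  rewrite mulrCA EFinM; apply: lee_wpmul2l; last exact: h1.
  by rewrite lee_fin.
Qed.

Lemma potential_lty (K : set 'rV[R]_n) : compact K -> K `<=` Omega ->
  \int[mu]_(x in K) kernel_op mu k absf0 x < +oo.
Proof.
move=> cK KO; have [C C0 hC] := kK cK KO.
apply: le_lt_trans (potential_le C0 (compact_measurable_rV cK) (aeW _ hC)) _.
by rewrite lte_mul_pinfty// ?lee_fin//; case/integrableP: fw_int.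
Qed.

(** This is the absolute convergence that the signed duality formula requires of bounded functions
    supported in a compact set. *)
Lemma indic_potential_lty (K : set 'rV[R]_n) (M : R) (g : 'rV[R]_n -> R) :
  compact K -> K `<=` Omega -> (0 <= M)%R -> measurable_fun setT g ->
  (forall x, (`|g x| <= M * \1_K x)%R) ->
  \int[mu]_x (`|g x|%:E * kernel_op mu k absf0 x) < +oo.
Proof.
move=> cK KO M0 mg gM; have mK := compact_measurable_rV cK.
have mkf := measurable_kernel_op mu mk mabsf0.
apply: (@le_lt_trans _ _ (M%:E * \int[mu]_(x in K) kernel_op mu k absf0 x)); last first.
  by rewrite lte_mul_pinfty// ?lee_fin//; exact: potential_lty.
rewrite [X in M%:E * X]integral_mkcond -ge0_integralZl_EFin//; last 2 first.
- by move=> x _; apply: erestrict_ge0.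
- by apply/(measurable_restrictT _ mK); exact: measurable_funTS.
apply: ge0_le_integral => //.
- by move=> x _; rewrite mule_ge0.
- by apply: emeasurable_funM => //; apply/measurable_EFinP; exact: measurableT_comp.
- apply: emeasurable_funM => //.
  by apply/(measurable_restrictT _ mK); exact: measurable_funTS.
move=> x _; have := gM x; rewrite patchE indicE; case: (x \in K) => /=.
  by rewrite mulr1 => h; apply: lee_wpmul2r.
by rewrite mulr0 normr_le0 => /eqP ->; rewrite normr0 mul0e mule0.
Qed.

(** Testing with the indicators of an exhaustion gives finiteness almost everywhere on each
    [K m]. *)
Lemma potential_fin_num :
  {ae mu, forall x, Omega x -> kernel_op mu k f0 x \is a fin_num}.
Proof.
have [K [cK KO OK]] := compact_exhaustion oO.
have aeK m : {ae mu, forall x, K m x -> kernel_op mu k f0 x \is a fin_num}.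
  have mK := compact_measurable_rV (cK m).
  have := @kernel_op_fin_num _ _ _ mu k mk k0 f0 (\1_(K m)) mf0 _ _.
  move=> /(_ (measurable_indic mK)) h.
  apply: filterS (h _) => [x hx Kx|].
    by apply: hx; rewrite indicE mem_set// oner_neq0.
  apply: (indic_potential_lty (cK m) (KO m) ler01).
    exact: measurable_indic.
  by move=> x; rewrite mul1r ger0_norm.
apply: filterS (ae_foralln aeK) => x hx Ox.
by have [m _ Km] := OK _ Ox; exact: (hx m).
Qed.

(** [fine] sends infinite values to 0; within [Omega] they occur on a null set only. *)
Let u x := fine (kernel_op mu k f0 x).

Lemma measurable_potential : measurable_fun setT u.
Proof.
by apply: measurableT_comp => //; exact: measurable_kernel_op.
Qed.

Lemma potential_green_op :
  {ae mu, forall x, Omega x -> green_op Omega G f x = (u x)%:E}.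
Proof.
apply: filterS2 (integral_kernel_op mO bk bf) potential_fin_num => x h1 h2 Ox.
by rewrite /green_op [LHS]h1// /u fineK//; exact: h2.
Qed.

Lemma integral_potential_le (K : set 'rV[R]_n) : measurable K ->
  \int[lam]_(x in K) `|(u x)%:E| <= \int[mu]_(x in K) kernel_op mu k absf0 x.
Proof.
move=> mK; have mu_ := measurable_potential.
have mau : measurable_fun setT (fun x => `|(u x)%:E|).
  by apply: measurableT_comp => //; exact/measurable_EFinP.
apply: (@le_trans _ _ (\int[mu]_(x in K) `|(u x)%:E|)).
  rewrite le_eqVlt; apply/orP; left; apply/eqP.
  by apply: integral_completion => //; exact: measurable_funTS.
apply: ge0_le_integral => //.
- exact: measurable_funTS.
- by apply: measurable_funTS; exact: measurable_kernel_op.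
move=> x Kx; apply: le_trans (le_abs_kernel_op mu mk k0 x mf0).
by rewrite /u; case: (kernel_op mu k f0 x) => [r| |]//=; rewrite normr0 ?leey.
Qed.

Lemma L1_loc_potential : L1_loc Omega u.
Proof.
have mu_ := measurable_potential.
split=> [|K cK KO].
  by apply: measurable_fun_completion => //; exact: measurable_funTS.
have mK := compact_measurable_rV cK.
apply/integrableP; split.
  apply: measurable_fun_completion => //; apply/measurable_EFinP.
  exact: measurable_funTS.
exact: le_lt_trans (integral_potential_le mK) (potential_lty cK KO).
Qed.

Lemma potential_dual (psi : 'rV[R]_n -> R) : Linfty_c Omega psi ->
  \int[lam]_(x in Omega) (u x * psi x)%:E =
  \int[lam]_(x in Omega) ((f x)%:E * green_op Omega G psi x).
Proof.
move=> [mpsi [M psiM] cS SO]; set S := closure _ in cS SO.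
have [psi0 bpsi] := exists_borel_version mO mpsi.
have [mpsi0 psi00 psi0E] := bpsi.
(* The sign of [M] is not given, hence the absolute value. *)
have psi0_le x : (`|psi0 x| <= `|M| * \1_S x)%R.
  have [->|[Ox e]] := psi00 x; first by rewrite normr0 mulr_ge0.
  rewrite e; have [->|nz] := eqVneq (psi x) 0%R; first by rewrite normr0 mulr_ge0.
  rewrite indicE mem_set ?mulr1; last by apply: subset_closure.
  exact: le_trans (psiM _ Ox) (ler_norm _).
have fin := indic_potential_lty cS SO (normr_ge0 M) mpsi0 psi0_le.
have psi0_out x : ~ Omega x -> psi0 x = 0%R.
  by case: (psi00 x) => // -[].
have mu_ := measurable_potential.
transitivity (\int[mu]_x ((psi0 x)%:E * kernel_op mu k f0 x)).
  apply: (integral_borel_version mO _ _ _).1.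
  - by apply: emeasurable_funM; [exact/measurable_EFinP|exact: measurable_kernel_op].
  - by move=> x nOx; rewrite psi0_out// mul0e.
  - apply: filterS2 potential_fin_num psi0E => x h1 h2 Ox.
    by rewrite h2// mulrC EFinM /u fineK//; exact: h1.
rewrite (kernel_op_dual mk k0 ksym mf0 mpsi0 fin); apply/esym.
apply: (integral_borel_version mO _ _ _).1.
- by apply: emeasurable_funM; [exact/measurable_EFinP|exact: measurable_kernel_op].
- by move=> x nOx; rewrite f0_out// mul0e.
- have [_ _ f0E] := bf.
  apply: filterS2 f0E (integral_kernel_op mO bk bpsi) => x h1 h2 Ox.
  by rewrite h1// /green_op h2.
Qed.

(** For measurable [E] inside [K m] the indicator of [E] is an admissible test function. So [v] and
    [u] have equal integrals over all such [E], which forces equality almost everywhere on [K m],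
    and then on [Omega] by exhaustion. *)
Lemma potential_unique (v : 'rV[R]_n -> R) :
  dual_solution Omega G f v -> ae_eq lam Omega v u.
Proof.
move=> [[mv vK] vdual]; have [_ uK] := L1_loc_potential.
have [K [cK KO OK]] := compact_exhaustion oO.
suff aeK m : {ae mu, forall x, K m x -> v x = u x}.
  have aeO : {ae mu, forall x, Omega x -> v x = u x}.
    apply: filterS (ae_foralln aeK) => x hx Ox.
    by have [m _ Km] := OK _ Ox; exact: (hx m).
  by apply/ae_completionP.
have mK := compact_measurable_rV (cK m); have mK' := measurable_completion mu mK.
have intE (E : set 'rV[R]_n) : E `<=` K m ->
    measurable (E : set (completionType mu)) ->
    \int[lam]_(x in E) (v x)%:E = \int[lam]_(x in E) (u x)%:E.
  move=> EK mE; have EO : E `<=` Omega by exact: subset_trans (KO m).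
  have linf : Linfty_c Omega (\1_E : 'rV[R]_n -> R).
    (* [E] need not be closed; its closure stays in [K m] because compact sets are closed. *)
    have sub : closure [set x : 'rV[R]_n | Omega x /\ (\1_E x : R) != 0%R] `<=` K m.
      have clK : closed (K m) by apply: compact_closed => //; exact: norm_hausdorff.
      move=> x cx; apply: clK; move: x cx; apply: closureS => x [_].
      by rewrite indicE; case: (boolP (x \in E)) => [|_]; [rewrite inE => /EK|rewrite eqxx].
    split.
    - exact: measurable_indic.
    - by exists 1%R => x _; rewrite indicE; case: (x \in E); rewrite ?normr1 ?normr0.
    - by apply: subclosed_compact sub => //; exact: closed_closure.
    - exact: subset_trans sub (KO m).
  have restr (g : 'rV[R]_n -> R) :
      \int[lam]_(x in E) (g x)%:E = \int[lam]_(x in Omega) (g x * \1_E x)%:E.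
    rewrite integral_mkcond [RHS]integral_mkcond; apply: eq_integral => x _.
    rewrite !patchE indicE; have [xE|xE] := boolP (x \in E).
      by rewrite mem_set ?mulr1//; apply: EO; rewrite inE in xE.
    by rewrite mulr0; case: ifP.
  by rewrite !restr (vdual _ linf) (potential_dual linf).
suff : ae_eq lam (K m) (EFin \o v) (EFin \o u).
  move=> /(@ae_completionP _ _ _ mu) h.
  have : {ae mu, forall x, K m x -> (v x)%:E = (u x)%:E} := h.
  by apply: filterS => x + Kx => /(_ Kx) [].
apply: integral_ae_eq => //; first exact: vK.
  by apply: measurable_int; exact: uK.
Qed.

End potential.

(** * The essential supremum norm and the conclusion *)

Section Lnorm_infty.
Context d (T : measurableType d) (R : realType) (mu : {measure set T -> \bar R}).
Local Open Scope ereal_scope.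

(** The norm is the essential supremum unless the whole space is null; in that case everything holds
    almost everywhere. *)
Lemma ae_le_Lnormy (F : T -> \bar R) : {ae mu, forall x, `|F x| <= 'N[mu]_+oo[F]}.
Proof.
rewrite unlock /=; case: ifPn => [_|]; first exact: (ess_sup_ge mu (abse \o F)).
rewrite lt0e negb_and negbK measure_ge0 orbF => /eqP mu0.
exact: measure0_ae.
Qed.

Lemma Lnormy_le (F : T -> \bar R) (C : \bar R) : 0 <= C ->
  {ae mu, forall x, `|F x| <= C} -> 'N[mu]_+oo[F] <= C.
Proof. by move=> C0 FC; rewrite unlock /=; case: ifPn => // _; apply/ess_supP. Qed.

End Lnorm_infty.

Lemma kernel_op_indic d (T : measurableType d) (R : realType)
    (mu : {sigma_finite_measure set T -> \bar R}) (k : T * T -> R) (K : set T) y :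
  kernel_op mu k \1_K y = (\int[mu]_(x in K) (k (y, x))%:E)%E.
Proof.
rewrite integral_mkcond; apply: eq_integral => x _.
by rewrite patchE indicE; case: ifPn => _; rewrite ?mulr1 ?mulr0.
Qed.

Theorem theorem2p5 (R : realType) (n : nat) (hn : (0 < n)%N)
    (Omega : set 'rV[R]_n) (hOmega : C11_bounded_domain Omega)
    (s gamma : R) (G : 'rV[R]_n -> 'rV[R]_n -> R)
    (hG : green_kernel s gamma Omega G)
    (f : 'rV[R]_n -> R) (hf : L1_weighted Omega gamma f) :
  exists u : 'rV[R]_n -> R,
    [/\ dual_solution Omega G f u,
        forall v : 'rV[R]_n -> R, dual_solution Omega G f v ->
          ae_eq (lebesgue R n) Omega v u,
        ae_eq (lebesgue R n) Omega (EFin \o u) (green_op Omega G f) &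
        forall K : set 'rV[R]_n, compact K -> K `<=` Omega ->
          (\int[lebesgue R n]_(x in K) `|(u x)%:E| <=
           'N[lebesgue R n]_1
             [(fun x => (f x * dist_bdry Omega x `^ gamma)%:E) \_ Omega] *
           'N[lebesgue R n]_+oo
             [(fun x => green_op Omega G \1_K x *
                        ((dist_bdry Omega x `^ gamma)^-1)%:E) \_ Omega])%E].
Proof.
have [neO oO _ bndO _] := hOmega; have [mf fw_int] := hf.
have [[/andP[s0 s1] /andP[g0 g1] sn] mG Gsym [A A0 GA]] := hG.
have bO := bdry_neq0 oO hn neO bndO.
pose mu := lebesgue_rV R n; pose w x := dist_bdry Omega x `^ gamma.
have w_gt0 x : Omega x -> 0 < w x.
  by move=> Ox; apply: powR_gt0; exact: dist_bdry_gt0.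
have mO := open_measurable_rV oO.
have [k bk] := exists_borel_kernel mO (@measurable_diag_rV R n)
  (fun x => lebesgue_rV_set1 x hn) mG Gsym.
have [mk ksym kG _] := bk.
have prof0 x y : 0 <= green_profile s gamma Omega x y by exact: green_profile_ge0.
(* Valid at all pairs: where [GA] does not apply, [k] vanishes. *)
have k_bounds x y : 0 <= k (x, y) <= A * green_profile s gamma Omega x y.
  have [->|[Ox Oy xy ->]] := kG x y; first by rewrite lexx mulr_ge0// ltW.
  have /GA /= /andP[lo ->] : [/\ Omega (x, y).1, Omega (x, y).2 & (x, y).1 != (x, y).2].
    by split => //=; exact/eqP.
  by rewrite andbT (le_trans _ lo)// mulr_ge0// invr_ge0 ltW.
have k0 p : 0 <= k p by case: p => x y; case/andP: (k_bounds x y).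
have kK K : compact K -> K `<=` Omega -> exists2 C : R, 0 <= C &
    forall y, Omega y -> (kernel_op mu k \1_K y <= (C * w y)%:E)%E.
  move=> cK KO.
  have [C C0 hC] := green_profile_integral_le s0 sn g0 oO bndO bO A0 cK KO.
  exists C => // y Oy; rewrite kernel_op_indic; apply: hC => //.
    by apply: measurable_funTS; exact: (measurable_fun_pair2 y mk).
  by move=> x _; rewrite ksym.
have [f0 bf] := exists_borel_version mO mf.
pose u x := fine (kernel_op mu k f0 x).
exists u; split.
- split; first exact: (L1_loc_potential oO k0 bk bf w_gt0 fw_int kK).
  move=> psi; exact: (potential_dual oO k0 bk bf w_gt0 fw_int kK).
- move=> v; exact: (potential_unique oO k0 bk bf w_gt0 fw_int kK).
- have h := potential_green_op oO k0 bk bf w_gt0 fw_int kK.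
  have h' : {ae mu, forall x, Omega x -> (EFin \o u) x = green_op Omega G f x}.
    by apply: filterS h => x + Ox => /(_ Ox) ->.
  by apply/ae_completionP.
move=> K cK KO; have mK := compact_measurable_rV cK.
set I := ('N[_]_1[_])%E; set F := (X in ('N[_]_+oo[X])%E).
(* The indicator is already Borel and vanishes outside [Omega], so it is its own version. *)
have b1K : borel_version mu Omega \1_K \1_K.
  split; [exact: measurable_indic| |exact: aeW].
  move=> x; have [Kx|nKx] := pselect (K x); first by right; split => //; exact: KO.
  by left; rewrite indicE memNset.
have FE : {ae mu, forall y, Omega y ->
    F y = (kernel_op mu k \1_K y * ((w y)^-1)%:E)%E}.
  apply: filterS (integral_kernel_op mO bk b1K) => y h Oy.
  by rewrite /F patchE mem_set// /green_op h.
have kop0 y : (0 <= kernel_op mu k \1_K y)%E by exact: kernel_op_ge0.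
have quot0 y : (0 <= kernel_op mu k \1_K y * ((w y)^-1)%:E)%E.
  by apply: mule_ge0 => //; rewrite lee_fin invr_ge0 powR_ge0.
have [C C0 hC] := kK K cK KO.
(* The constant [C] serves only to make the norm finite, so that [fine] recovers it. *)
have N_le : ('N[lebesgue R n]_+oo[F] <= C%:E)%E.
  apply: Lnormy_le; first by rewrite lee_fin.
  have aeC : {ae mu, forall y, `|F y| <= C%:E}%E.
    apply: filterS FE => y hy; have [Oy|nOy] := pselect (Omega y); last first.
      have -> : F y = 0%E by rewrite /F patchE memNset.
      by rewrite abse0 lee_fin.
    rewrite hy// gee0_abs; last exact: quot0.
    by rewrite lee_pdivrMr ?w_gt0// -EFinM; exact: hC.
  by apply/ae_completionP.
have N0 := Lnorm_ge0 (lebesgue R n) +oo%E F.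
have N_fin : 'N[lebesgue R n]_+oo[F]%E \is a fin_num.
  by rewrite ge0_fin_numE// (le_lt_trans N_le)// ltry.
(* The norm itself is now an admissible constant in [potential_le], which yields the sharp form of
   the estimate. *)
have aeN : {ae mu, forall y, Omega y ->
    kernel_op mu k \1_K y <= (fine ('N[lebesgue R n]_+oo[F]) * w y)%:E}%E.
  have leN : {ae mu, forall y, `|F y| <= 'N[lebesgue R n]_+oo[F]}%E.
    by apply/(@ae_completionP _ _ _ mu); exact: ae_le_Lnormy.
  apply: filterS2 FE leN => y hy le_y Oy; move: le_y.
  rewrite hy// gee0_abs; last exact: quot0.
  by rewrite lee_pdivrMr ?w_gt0// EFinM fineK.
apply: (le_trans (integral_potential_le k0 bk bf mK)).
apply: le_trans (potential_le oO k0 bk bf w_gt0 fw_int _ mK aeN) _.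
  exact: fine_ge0.
rewrite fineK// muleC /I Lnorm1 [in leLHS]integral_mkcond.
rewrite le_eqVlt; apply/orP; left; apply/eqP; congr (_ * _)%E.
apply: eq_integral => x _; rewrite !patchE.
by case: ifP => // _; rewrite [RHS]abse0.
Qed.
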